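(* Let $R$ be a unital Banach algebra with norm $\|\cdot\|$ and identity $I$. Let $A,B,Z\in R$ be (in general noncommuting) parameters and let $Q\in R$ be the base. Suppose that $Q$ and $A$ both commute with each of the other parameters (while $B$ and $Z$ need not commute with each other). Assume that $\|Z\|<1$ and $\|A^{-1}Z^{-1}B\|<1$. Then the following two summations for reversed noncommutative bilateral series hold. (Reversed type I) $$ {}_1\psi_1^{\;\sim}\!\left\lceil\!\begin{array}{c}A\\ B\end{array}\!;Q,Z\right\rfloor= Z\;{}^{\sim}\!\left\lfloor\!\begin{array}{c}A^{-1}Z^{-1}Q\\ A^{-1}Z^{-1}B\end{array}\!;Q,I\right\rceil_\infty {}^{\sim}\!\left\lceil\!\begin{array}{c}ZA\\ Z^{-1}BZ\end{array}\!;Q,I\right\rfloor_\infty {}^{\sim}\!\left\lfloor\!\begin{array}{c}A^{-1}Z^{-1}BZ,\;Q\\ Z,\;A^{-1}Q\end{array}\!;Q,I\right\rceil_\infty Z^{-1} . $$ (Reversed type II) $$ {}_1\psi_1^{\;\sim}\!\left\lfloor\!\begin{array}{c}A\\ B\end{array}\!;Q,Z\right\rceil= Z\left\lfloor\!\begin{array}{c}BA^{-1}\\ Z\end{array}\!;Q,I\right\rceil_\infty {}^{\sim}\!\left\lfloor\!\begin{array}{c}Q,\;ZA\\ B,\;A^{-1}Q\end{array}\!;Q,I\right\rceil_\infty \left\lfloor\!\begin{array}{c}A^{-1}Z^{-1}Q\\ A^{-1}Z^{-1}B\end{array}\!;Q,I\right\rceil_\infty Z^{-1} . $$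
   Context: $R$ is a unital Banach algebra with norm $\|\cdot\|$, identity $I$ and zero $O$; its elements do not commute in general. The base $Q\in R$ commutes with all other parameters that appear (for instance $Q=qI$, $q$ a scalar), and $\|Q\|<1$. All expressions that appear are implicitly assumed to be well defined; in particular, whenever an inverse $X^{-1}$ is written (also inside the definitions below, including the products with negative index and the negative powers of $Q$ in them), its existence is assumed. Ordered products. For integers $l,m$, $$\prod_{j=l}^m X_j=\begin{cases} I & m=l-1,\\ X_lX_{l+1}\cdots X_m & m\ge l,\\ X_{l-1}^{-1}X_{l-2}^{-1}\cdots X_{m+1}^{-1} & m<l-1.\end{cases}$$ Products $\prod_{i=1}^r$ are ordered in the same way, with $i$ increasing from left to right. Noncommutative $Q$-shifted factorials. For an integer $k$ (possibly negative): type II: $$\left\lfloor\!\begin{array}{c}A_1,\dots,A_r\\ B_1,\dots,B_r\end{array}\!;Q,Z\right\rceil_k=\prod_{j=1}^k\left[\left(\prod_{i=1}^r(I-B_iQ^{j-1})^{-1}(I-A_iQ^{j-1})\right)Z\right];$$ reversed type I: $${}^{\sim}\!\left\lceil\!\begin{array}{c}A_1,\dots,A_r\\ B_1,\dots,B_r\end{array}\!;Q,Z\right\rfloor_k=\prod_{j=1}^k\left(Z\prod_{i=1}^r(I-A_iQ^{j-1})(I-B_iQ^{j-1})^{-1}\right);$$ reversed type II: $${}^{\sim}\!\left\lfloor\!\begin{array}{c}A_1,\dots,A_r\\ B_1,\dots,B_r\end{array}\!;Q,Z\right\rceil_k=\prod_{j=1}^k\left(Z\prod_{i=1}^r(I-A_iQ^{k-j})(I-B_iQ^{k-j})^{-1}\right).$$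 For $k=\infty$ these denote the limits in $R$ as $k\to\infty$ of the corresponding expressions. Reversed noncommutative bilateral basic hypergeometric series of type I and type II: $${}_1\psi_1^{\;\sim}\!\left\lceil\!\begin{array}{c}A\\ B\end{array}\!;Q,Z\right\rfloor=\sum_{k=-\infty}^{\infty}{}^{\sim}\!\left\lceil\!\begin{array}{c}A\\ B\end{array}\!;Q,Z\right\rfloor_k,\qquad {}_1\psi_1^{\;\sim}\!\left\lfloor\!\begin{array}{c}A\\ B\end{array}\!;Q,Z\right\rceil=\sum_{k=-\infty}^{\infty}{}^{\sim}\!\left\lfloor\!\begin{array}{c}A\\ B\end{array}\!;Q,Z\right\rceil_k .$$ *)

(* Defs.v *)
From HB Require Import structures.
From mathcomp Require Import all_boot all_order all_algebra.
From mathcomp Require Import all_classical all_reals all_analysis.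

Set Implicit Arguments.
Unset Strict Implicit.
Unset Printing Implicit Defensive.

Import Order.TTheory GRing.Theory Num.Theory.
Import numFieldNormedType.Exports.

Local Open Scope classical_set_scope.
Local Open Scope ring_scope.

(* Unital Banach algebras over K.  The identity is not required to have norm 1,
   so both usual conventions are covered.  This is a record over a complete
   normed module, not an HB structure joining completeNormedModType with
   unitAlgType: HB rejects this join because numDomainType already has both a
   norm and a ring structure. *)
Record banachAlgType (K : numFieldType) := BanachAlg {
  banach_base : completeNormedModType K;
  banach_one : banach_base;
  banach_mul : banach_base -> banach_base -> banach_base;
  banach_mulA : associative banach_mul;
  banach_mul1x : left_id banach_one banach_mul;
  banach_mulx1 : right_id banach_one banach_mul;
  banach_mulDl : left_distributive banach_mul +%R;
  banach_mulDr : right_distributive banach_mul +%R;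
  banach_one_neq0 : banach_one != 0;
  banach_scaleAl : forall (a : K) (x y : banach_base),
    a *: banach_mul x y = banach_mul (a *: x) y;
  banach_scaleAr : forall (a : K) (x y : banach_base),
    a *: banach_mul x y = banach_mul x (a *: y);
  banach_normM : forall x y : banach_base,
    `|banach_mul x y| <= `|x| * `|y|
}.

(* The carrier, as a constant on which all the structures are declared. *)
Definition banach_sort (K : numFieldType) (V : banachAlgType K) : Type :=
  banach_base V.
Coercion banach_sort : banachAlgType >-> Sortclass.

Section BanachInstances.
Variables (K : numFieldType) (V : banachAlgType K).

HB.instance Definition _ := CompleteNormedModule.copy (banach_sort V) (banach_base V).

HB.instance Definition _ := GRing.Zmodule_isNzRing.Build (banach_sort V)
  (@banach_mulA K V) (@banach_mul1x K V) (@banach_mulx1 K V)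
  (@banach_mulDl K V) (@banach_mulDr K V) (@banach_one_neq0 K V).

HB.instance Definition _ :=
  GRing.Lmodule_isLalgebra.Build K (banach_sort V) (@banach_scaleAl K V).
HB.instance Definition _ :=
  GRing.Lalgebra_isAlgebra.Build K (banach_sort V) (@banach_scaleAr K V).

Let invertible (x : banach_sort V) : Prop := exists y, y * x = 1 /\ x * y = 1.

Definition banach_unit : {pred banach_sort V} := fun x => `[< invertible x >].

Definition banach_inv (x : banach_sort V) : banach_sort V :=
  if pselect (invertible x) is left h then projT1 (cid h) else x.

Fact banach_mulVx : {in banach_unit, left_inverse 1 banach_inv *%R}.
Proof.
move=> x /asboolP hx; rewrite /banach_inv.
by case: pselect => // h; case: (cid h) => y [].
Qed.

Fact banach_mulxV : {in banach_unit, right_inverse 1 banach_inv *%R}.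
Proof.
move=> x /asboolP hx; rewrite /banach_inv.
by case: pselect => // h; case: (cid h) => y [].
Qed.

Fact banach_unitP (x y : banach_sort V) : y * x = 1 /\ x * y = 1 -> banach_unit x.
Proof. by move=> h; apply/asboolP; exists y. Qed.

Fact banach_inv_out : {in [predC banach_unit], banach_inv =1 id}.
Proof.
move=> x /negP hx; rewrite /banach_inv.
by case: pselect => // h; case: hx; apply/asboolP.
Qed.

HB.instance Definition _ := GRing.NzRing_hasMulInverse.Build (banach_sort V)
  banach_mulVx banach_mulxV banach_unitP banach_inv_out.

Lemma banach_normrM (x y : V) : `|x * y| <= `|x| * `|y|.
Proof. exact: banach_normM. Qed.

End BanachInstances.

(* X_l X_(l+1) ... X_m if l <= m + 1 (an empty product if l = m + 1), and
   X_(l-1)^-1 X_(l-2)^-1 ... X_(m+1)^-1 if m < l - 1. *)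
Definition oprod (V : unitRingType) (l m : int) (X : int -> V) : V :=
  if l - 1 <= m then \prod_(i < absz (m - (l - 1))%R) X (l + i%:Z)
  else \prod_(i < absz (l - 1 - m)%R) (X (l - 1 - i%:Z))^-1.

(* Noncommutative Q-shifted factorials with rows A and B: qfac2 is of type II,
   rqfac1 and rqfac2 are reversed of types I and II.  They are meaningful only
   when all the inverted elements are units, as x^-1 = x for other x. *)
Section Factorials.
Variables (V : unitRingType) (r : nat) (A B : r.-tuple V) (Q Z : V).

Definition qfac2 (k : int) : V :=
  oprod 1 k (fun j =>
    (\prod_(i < r) ((1 - tnth B i * Q ^ (j - 1))^-1
                    * (1 - tnth A i * Q ^ (j - 1)))) * Z).

Definition rqfac1 (k : int) : V :=
  oprod 1 k (fun j =>
    Z * \prod_(i < r) ((1 - tnth A i * Q ^ (j - 1))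
                       * (1 - tnth B i * Q ^ (j - 1))^-1)).

Definition rqfac2 (k : int) : V :=
  oprod 1 k (fun j =>
    Z * \prod_(i < r) ((1 - tnth A i * Q ^ (k - j))
                       * (1 - tnth B i * Q ^ (k - j))^-1)).

End Factorials.

Section Limits.
Variables (K : numFieldType) (V : normedModType K).
Implicit Type f : int -> V.

Definition oo_cvg f : Prop := cvgn (fun n : nat => f n%:Z).
Definition oo_lim f : V := limn (fun n : nat => f n%:Z).

(* The series over the indices k >= 0 and the one over the indices k < 0
   (Negz n is -(n+1)) are required to converge separately. *)
Definition bilateral_cvg f : Prop :=
  cvgn (series (fun n : nat => f n%:Z)) /\ cvgn (series (fun n : nat => f (Negz n))).
Definition bilateral_sum f : V :=
  limn (series (fun n : nat => f n%:Z)) + limn (series (fun n : nat => f (Negz n))).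

End Limits.

Definition rpsi1 (K : numFieldType) (V : banachAlgType K) (A B Q Z : V) : V :=
  bilateral_sum (rqfac1 [tuple A] [tuple B] Q Z).

Definition rpsi2 (K : numFieldType) (V : banachAlgType K) (A B Q Z : V) : V :=
  bilateral_sum (rqfac2 [tuple A] [tuple B] Q Z).

(* Main.v *)
Require Import Defs.
From HB Require Import structures.
From mathcomp Require Import all_boot all_order all_algebra.
From mathcomp Require Import zify ring lra.
From mathcomp Require Import all_classical all_reals all_analysis.

Set Implicit Arguments.
Unset Strict Implicit.
Unset Printing Implicit Defensive.

Import Order.TTheory GRing.Theory Num.Theory.
Import numFieldNormedType.Exports.

Local Open Scope classical_set_scope.
Local Open Scope ring_scope.

(** Put C = Z A and, for fixed B and C, let a = A^-1 vary: up to conjugation by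
   Z, the k-th term of the bilateral series is the product of the factors
   (a - Q^i) C (1 - B Q^i)^-1, i < k, and the sum G(a) satisfies the contiguous
   relation
     G(a Q) (1 - a B) = G(a) (1 - a C) (1 - a Q),
   which holds termwise up to an index shift.  Iterated from a and from 1, it
   expresses G(a) through lim G(a Q^n) = G(0), and G(0) = lim G(Q^n) through
   G(1).  At a = 1 the series terminates on the right, and what remains is a
   noncommutative q-binomial series in c = C^-1, which is summed by iterating
   its own recurrence c -> c Q.  Reversed type II is the same identity in the
   opposite algebra. *)

(** * Ordered products and the opposite algebra *)

(** Varying a while B and C stay fixed separates the two hypotheses: |a C| = |Z| < 1 controls the
    indices k >= 0, and |B c| < 1 controls the indices k < 0 whatever a is. Both bounds survive
    along a Q^n, so dominated convergence reaches a = 0. Since a commutes with everything but B and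
    C do not commute, the side on which a new factor appears decides which kind of infinite product
    results. From a, the relation is solved for G(a): 1 - a C Q^n is inverted by a Neumann series
    and new factors pile up on the left, which gives a reversed product. From 1 this is impossible,
    because C = Z A has no norm bound and 1 - C Q^n may be singular. There the relation is solved
    for G(Q^(n+1)) by inverting 1 - B Q^n, and new factors pile up on the right. Convergence at Q^n
    then comes from termination, not from smallness. *)

Definition lprod (V : nzRingType) (F : nat -> V) (n : nat) : V := \prod_(i < n) F i.

Definition rprod (V : nzRingType) (F : nat -> V) (n : nat) : V :=
  \prod_(i < n) F (n - i.+1)%N.

Section OrderedProducts.
Variable V : nzRingType.
Implicit Type F : nat -> V.

Lemma lprod0 F : lprod F 0 = 1.
Proof. exact: big_ord0. Qed.

Lemma rprod0 F : rprod F 0 = 1.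
Proof. exact: big_ord0. Qed.

Lemma lprodS F n : lprod F n.+1 = lprod F n * F n.
Proof. exact: big_ord_recr. Qed.

Lemma rprodS F n : rprod F n.+1 = F n * rprod F n.
Proof.
by rewrite /rprod big_ord_recl /= subSS subn0; congr (_ * _).
Qed.

Lemma lprodSl F n : lprod F n.+1 = F 0 * lprod (fun i => F i.+1) n.
Proof. by rewrite /lprod big_ord_recl. Qed.

Lemma eq_lprod F G : F =1 G -> lprod F =1 lprod G.
Proof. by move=> FG n; apply: eq_bigr => i _; rewrite FG. Qed.

Lemma eq_rprod F G : F =1 G -> rprod F =1 rprod G.
Proof. by move=> FG n; apply: eq_bigr => i _; rewrite FG. Qed.

Lemma commr_lprod F x : (forall i, GRing.comm x (F i)) ->
  forall n, GRing.comm x (lprod F n).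
Proof. by move=> xF n; apply: commr_prod => i _; exact: xF. Qed.

Lemma commr_rprod F x : (forall i, GRing.comm x (F i)) ->
  forall n, GRing.comm x (rprod F n).
Proof. by move=> xF n; apply: commr_prod => i _; exact: xF. Qed.

Lemma lprodM F G : (forall i j, GRing.comm (F i) (G j)) ->
  forall n, lprod (fun i => F i * G i) n = lprod F n * lprod G n.
Proof.
move=> FG; elim=> [|n IH]; first by rewrite !lprod0 mulr1.
rewrite !lprodS IH !mulrA; congr (_ * _); rewrite -!mulrA; congr (_ * _).
by apply/esym/commr_lprod => i; exact: FG.
Qed.

Lemma mulr_comm_interchange (x y z t : V) :
  GRing.comm y z -> GRing.comm y t -> (x * y) * (z * t) = (x * z) * (t * y).
Proof.
by move=> yz yt; rewrite -[LHS]mulrA (mulrA y) yz -(mulrA z) yt -[RHS]mulrA.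
Qed.

Lemma rprodM F G :
  (forall i j, GRing.comm (G i) (F j)) ->
  forall n, rprod (fun i => F i * G i) n = rprod F n * rprod G n.
Proof.
move=> GF; elim=> [|n IH]; first by rewrite !rprod0 mulr1.
rewrite !rprodS IH !mulrA; congr (_ * _); rewrite -!mulrA; congr (_ * _).
by apply: commr_rprod => i; exact: GF.
Qed.

Lemma rprod_lprod F :
  (forall i j, GRing.comm (F i) (F j)) -> rprod F =1 lprod F.
Proof.
move=> FF; elim=> [|n IH]; first by rewrite rprod0 lprod0.
by rewrite rprodS lprodS IH; apply: commr_lprod => i; exact: FF.
Qed.

End OrderedProducts.

Section Opposite.
Variables (K : numFieldType) (V : banachAlgType K).

Fact banach_op_normM (x y : banach_base V) : `|banach_mul y x| <= `|x| * `|y|.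
Proof. by rewrite mulrC banach_normM. Qed.

(** The underlying complete normed module is kept, so norms, sums and limits in both algebras are
    convertible. Only powers, inverses and ordered products need transport lemmas. *)
Definition banach_op : banachAlgType K :=
  @BanachAlg K (banach_base V) (banach_one V) (fun x y => banach_mul y x)
   (fun x y z => esym (banach_mulA z y x)) (@banach_mulx1 K V) (@banach_mul1x K V)
   (fun x y z => banach_mulDr z x y) (fun x y z => banach_mulDl y z x)
   (@banach_one_neq0 K V)
   (fun a x y => banach_scaleAr a y x) (fun a x y => banach_scaleAl a y x)
   banach_op_normM.

End Opposite.

Section OppositeTheory.
Variables (K : numFieldType) (V : banachAlgType K).
Local Notation W := (banach_op V).

Lemma opM (x y : V) : (x : W) * (y : W) = y * x :> V.
Proof. by []. Qed.

Lemma opB (x y : V) : (x : W) - (y : W) = x - y :> V.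
Proof. by []. Qed.

Lemma opX (x : V) n : (x : W) ^+ n = x ^+ n :> V.
Proof. by elim: n => // n IH; rewrite exprS exprSr opM IH. Qed.

Lemma op_unit (x : V) : ((x : W) \is a GRing.unit) = (x \is a GRing.unit).
Proof.
apply/idP/idP => /unitrP [y [yx xy]]; apply/unitrP; exists y; split.
- exact: xy.
- exact: yx.
- exact: xy.
- exact: yx.
Qed.

(** Each algebra chooses its inverses independently, so this is not a conversion: on units it is
    uniqueness of the inverse, elsewhere both sides default to [x]. *)
Lemma opV (x : V) : (x : W)^-1 = x^-1 :> V.
Proof.
have [xU|xN] := boolP (x \is a GRing.unit).
  apply: (mulrI xU); rewrite mulrV //.
  have xW : (x : W) \is a GRing.unit by rewrite op_unit.
  exact: mulVr xW.
have xW : (x : W) \isn't a GRing.unit by rewrite op_unit.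
exact: etrans (invr_out xW) (esym (invr_out xN)).
Qed.

Lemma op_lprod (F : nat -> V) : lprod (F : nat -> W) = rprod F :> (nat -> V).
Proof.
apply/funext; elim=> [|n IH]; first by rewrite lprod0 rprod0.
by rewrite lprodS rprodS opM IH.
Qed.

Lemma op_rprod (F : nat -> V) : rprod (F : nat -> W) = lprod F :> (nat -> V).
Proof.
apply/funext; elim=> [|n IH]; first by rewrite lprod0 rprod0.
by rewrite lprodS rprodS opM IH.
Qed.

End OppositeTheory.

(** * Series and products in Banach algebras *)

Section NormedSequences.
Variables (K : realType) (V : completeNormedModType K).

Lemma norm_le_cvg0 (u : nat -> V) (b : nat -> K) :
  (forall n, `|u n| <= b n) -> b @ \oo --> 0 -> u @ \oo --> 0.
Proof.
move=> ub b0; apply/norm_cvg0P.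
apply: (@squeeze_cvgr _ _ _ _ (cst 0) b) => //; last exact: cvg_cst.
by apply: nearW => n; rewrite normr_ge0 ub.
Qed.

Lemma cvg_seriesS (u : nat -> V) : cvgn (series u) ->
  (fun n => series u n.+1) @ \oo --> limn (series u).
Proof. by move=> cu; rewrite (cvg_shiftS (series u)). Qed.

Lemma geo_cvg_series (u : nat -> V) (M r : K) : 0 <= r < 1 -> 0 <= M ->
  (forall k, `|u k| <= M * r ^+ k) -> cvgn (series u).
Proof.
move=> /andP[r0 r1] M0 uM; apply: normed_cvg.
apply: (@series_le_cvg _ _ (geometric M r)) => //.
- by move=> n; exact: normr_ge0.
- by move=> n; exact: geometric_ge0.
- by apply: is_cvg_geometric_series; rewrite ger0_norm.
Qed.

Lemma geo_series_tail (u : nat -> V) (M r : K) : 0 <= r < 1 -> 0 <= M ->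
  (forall k, `|u k| <= M * r ^+ k) ->
  forall n, `|limn (series u) - series u n| <= M / (1 - r) * r ^+ n.
Proof.
move=> r01 M0 uM n; have cu := geo_cvg_series r01 M0 uM.
have /andP[r0 r1] := r01.
set C := M / (1 - r); have C0 : 0 <= C by rewrite divr_ge0 // subr_ge0 ltW.
have CM : C * (1 - r) = M by rewrite divfK // subr_eq0 gt_eqF.
(* As C (1 - r) = M, each new bound M r^(n+d) is exactly the increment of the right-hand side, so
   the induction closes without loss. *)
have tail d : `|series u (n + d)%N - series u n| <= C * r ^+ n - C * r ^+ (n + d).
  elim: d => [|d IH]; first by rewrite addn0 !subrr normr0.
  rewrite addnS seriesSr -addrA [u _ - _]addrC addrA.
  apply: le_trans (ler_normD _ _) _.
  apply: le_trans (lerD IH (uM _)) _.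
  by rewrite -CM exprS le_eqVlt; apply/orP; left; apply/eqP; ring.
have shift : [sequence series u (d + n)%N]_d @ \oo --> limn (series u).
  by rewrite cvg_shiftn.
have lim_tail : `|series u (d + n)%N - series u n| @[d --> \oo] -->
    `|limn (series u) - series u n|.
  by apply: cvg_norm; apply: cvgB shift _; exact: cvg_cst.
apply: (cvgr_to_le lim_tail).
apply: nearW => d; rewrite addnC; apply: le_trans (tail d) _.
by rewrite gerBl mulr_ge0 ?exprn_ge0.
Qed.

(** Dominated convergence for series: both tails after a large N are at most e/3 uniformly in n, and
    the first N terms converge one by one. *)
Lemma tannery (u : nat -> nat -> V) (v : nat -> V) (M r : K) :
  0 <= r < 1 -> 0 <= M -> (forall n k, `|u n k| <= M * r ^+ k) ->
  (forall k, u ^~ k @ \oo --> v k) ->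
  (fun n => limn (series (u n))) @ \oo --> limn (series v).
Proof.
move=> r01 M0 uM uv; have /andP[r0 r1] := r01.
have vM k : `|v k| <= M * r ^+ k.
  by apply: (cvgr_to_le (cvg_norm (uv k))); exact: nearW.
have fin k : (fun n => series (u n) k) @ \oo --> series v k.
  elim: k => [|k IH].
    rewrite [series v 0]big_geq //.
    rewrite (_ : (fun _ => _) = cst 0); first exact: cvg_cst.
    by apply/funext => n; rewrite [LHS]big_geq.
  rewrite seriesSr (_ : (fun _ => _) = (fun n => series (u n) k + u n k)).
    exact: cvgD.
  by apply/funext => n; rewrite seriesSr.
set C := M / (1 - r).
have C0 : 0 <= C by rewrite divr_ge0 // subr_ge0 ltW.
apply/cvgrPdist_le => e e0.
have [N _ HN] : \forall N \near \oo, C * r ^+ N <= e / 3.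
  apply: (@cvgr_le _ _ _ _ _ 0); last by rewrite divr_gt0.
  by apply: cvg_geometric; rewrite ger0_norm.
have {}HN := HN N (leqnn N).
near=> n.
rewrite (_ : _ - _ = (limn (series v) - series v N) +
  (series v N - series (u n) N) - (limn (series (u n)) - series (u n) N)).
  apply: le_trans (ler_normB _ _) _.
  apply: le_trans (lerD (ler_normD _ _) (geo_series_tail r01 M0 (uM n) N)) _.
  apply: le_trans (lerD (lerD (geo_series_tail r01 M0 vM N) (lexx _)) (lexx _)) _.
  rewrite -/C.
  have : `|series v N - series (u n) N| <= e / 3.
    by near: n; apply: cvgr_dist_le; [exact: fin | rewrite divr_gt0].
  by lra.
by rewrite opprB addrA addrA subrK addrC addrA addrA subrK addrC.
Unshelve. all: by end_near. Qed.

End NormedSequences.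

Section GeometricBounds.
Variable K : realType.

(** The quotient of the product by r^k does not increase once the factors are at most r. The sum of
    its values up to that point serves as an upper bound for their maximum. *)
Lemma prod_le_geo (W : nat -> K) (r : K) : 0 < r -> (forall j, 0 <= W j) ->
  (\forall j \near \oo, W j <= r) ->
  exists2 M, 0 <= M & forall k, \prod_(j < k) W j <= M * r ^+ k.
Proof.
move=> r0 W0 [N _ HN].
pose b k := \prod_(j < k) W j / r ^+ k.
have b0 k : 0 <= b k by rewrite divr_ge0 ?exprn_ge0 ?prodr_ge0 // ltW.
exists (\sum_(k < N.+1) b k); first exact: sumr_ge0.
move=> k; rewrite -ler_pdivrMr ?exprn_gt0 // -/(b k).
have small i : (i <= N)%N -> b i <= \sum_(k < N.+1) b k.
  move=> iN; rewrite (bigD1 (Ordinal (iN : (i < N.+1)%N))) //= lerDl.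
  exact: sumr_ge0.
have [|/ltnW Nk] := leqP k N; first exact: small.
rewrite -(subnKC Nk); elim: (k - N)%N => [|d IH]; first by rewrite addn0 small.
apply: le_trans IH; rewrite addnS /b big_ord_recr /= exprSr invfM mulrACA.
rewrite ler_piMr //; first exact: b0.
by rewrite mulrC ler_pdivrMl // mulr1 HN //= leq_addr.
Qed.

Lemma prod_perturbed_le_geo (w s t q r : K) : 0 <= w < r -> 0 <= s -> 0 <= t ->
  0 <= q < 1 ->
  exists2 M, 0 <= M &
    forall k, \prod_(j < k) ((w + s * q ^+ j) * (1 + t * q ^+ j)) <= M * r ^+ k.
Proof.
move=> /andP[w0 wr] s0 t0 /andP[q0 q1].
apply: (@prod_le_geo (fun j => (w + s * q ^+ j) * (1 + t * q ^+ j))).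
- exact: le_lt_trans w0 wr.
- by move=> j; rewrite mulr_ge0 // addr_ge0 // mulr_ge0 ?exprn_ge0.
have pert x y : (fun j : nat => x + y * q ^+ j) @ \oo --> x + 0.
  apply: cvgD; first exact: cvg_cst.
  by have := @cvg_geometric K y q; rewrite ger0_norm //; apply.
have lim_w := cvgM (pert w s) (pert 1 t).
by rewrite !addr0 mulr1 in lim_w; exact: cvgr_le _ (lim_w _) _ wr.
Qed.

End GeometricBounds.

Section BanachSequences.
Variables (K : realType) (V : banachAlgType K).

Lemma banach_cvgM (u v : nat -> V) (x y : V) :
  u @ \oo --> x -> v @ \oo --> y -> (fun n => u n * v n) @ \oo --> x * y.
Proof.
move=> ux vy; apply/(subr_cvg0 _ (x * y)).
apply: (@norm_le_cvg0 K V _ (fun n => `|u n - x| * `|v n| + `|x| * `|v n - y|)).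
  move=> n; rewrite (_ : _ - _ = (u n - x) * v n + x * (v n - y)).
    by apply: le_trans (ler_normD _ _) _; apply: lerD; exact: banach_normrM.
  by rewrite mulrBl mulrBr addrA subrK.
rewrite (_ : 0 = 0 * `|y| + `|x| * 0 :> K); last by rewrite mul0r mulr0 addr0.
apply: cvgD; apply: cvgM; try exact: cvg_cst.
- by apply/norm_cvg0P; apply/subr_cvg0.
- exact: cvg_norm.
- by apply/norm_cvg0P; apply/subr_cvg0.
Qed.

Lemma commr_lim (u v : nat -> V) :
  cvgn u -> cvgn v -> (forall n, GRing.comm (u n) (v n)) ->
  GRing.comm (limn u) (limn v).
Proof.
move=> cu cv uv; apply: (cvg_unique (@norm_hausdorff K V) (banach_cvgM cu cv)).
by rewrite (funext uv); exact: banach_cvgM.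
Qed.

Lemma cvg_lprod (F : nat -> nat -> V) (G : nat -> V) :
  (forall i, F ^~ i @ \oo --> G i) ->
  forall k, (fun n => lprod (F n) k) @ \oo --> lprod G k.
Proof.
move=> FG; elim=> [|k IH].
  rewrite lprod0 (_ : (fun _ => _) = cst 1); first exact: cvg_cst.
  by apply/funext => n; rewrite lprod0.
rewrite lprodS (_ : (fun _ => _) = (fun n => lprod (F n) k * F n k)).
  by apply: banach_cvgM.
by apply/funext => n; rewrite lprodS.
Qed.

Lemma norm_lprod_le (F : nat -> V) (W : nat -> K) : (forall j, `|F j| <= W j) ->
  forall k, `|lprod F k| <= `|1 : V| * \prod_(j < k) W j.
Proof.
move=> FW; elim=> [|k IH]; first by rewrite lprod0 big_ord0 mulr1.
rewrite lprodS big_ord_recr /= mulrA.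
by apply: le_trans (banach_normrM _ _) _; apply: ler_pM.
Qed.

(* The norm of 1 may exceed 1, so a factor y close to 1 is estimated through
   y - 1 and not through its own norm. *)
Lemma norm_mul1D (x y : V) (s : K) : `|y - 1| <= s -> `|x * y| <= `|x| * (1 + s).
Proof.
move=> ys; rewrite (_ : x * y = x + x * (y - 1)); last first.
  by rewrite mulrBr mulr1 addrC subrK.
rewrite [leRHS]mulrDr mulr1.
apply: le_trans (ler_normD _ _) _; rewrite lerD2l.
by apply: le_trans (banach_normrM _ _) _; rewrite ler_wpM2l.
Qed.

Lemma lprod_cvg (F : nat -> V) (s q : K) : 0 <= s -> 0 <= q < 1 ->
  (forall j, `|F j - 1| <= s * q ^+ j) -> cvgn (lprod F).
Proof.
move=> s0 q01 Fs; have /andP[q0 q1] := q01.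
have q2 : 0 < 1 + q by lra.
(* The partial products are only bounded by a multiple of t^k. Any t > 1 with t q < 1 is enough,
   since the increments gain q^k; t = 2 / (1 + q) is such a number. *)
have [t t1 tq1] : exists2 t : K, 1 < t & t * q < 1.
  exists (2 / (1 + q)); first by rewrite ltr_pdivlMr //; lra.
  by rewrite mulrAC ltr_pdivrMr //; lra.
have t0 : 0 <= t by apply: ltW; apply: lt_trans t1.
have w1 : 0 <= (1 : K) < t by rewrite ler01.
have [M M0 HM] := prod_perturbed_le_geo w1 (lexx 0) s0 q01.
have bnd k : `|lprod F k| <= `|1 : V| * (M * t ^+ k).
  have : `|lprod F k| <= `|1 : V| * \prod_(j < k) (1 + s * q ^+ j).
    elim: k => [|k IH]; first by rewrite lprod0 big_ord0 mulr1.
    rewrite lprodS big_ord_recr /= mulrA.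
    apply: le_trans (norm_mul1D _ (Fs k)) _.
    by rewrite ler_wpM2r // addr_ge0 // mulr_ge0 ?exprn_ge0.
  move=> /le_trans; apply; rewrite ler_wpM2l //.
  by have := HM k; under eq_bigr do rewrite mul0r addr0 mul1r.
(* The partial product is 1 plus the series of its increments, and this series is dominated by a
   geometric one of ratio t q. *)
rewrite (_ : lprod F = (fun n => series (fun k => lprod F k * (F k - 1)) n + 1)).
  apply: is_cvgD; last exact: is_cvg_cst.
  apply: (@geo_cvg_series K V _ (`|1 : V| * M * s) (t * q)).
  - by rewrite tq1 mulr_ge0.
  - by rewrite !mulr_ge0.
  move=> k; apply: le_trans (banach_normrM _ _) _.
  apply: le_trans (ler_pM _ _ (bnd k) (Fs k)) _ => //.
  by rewrite exprMn le_eqVlt; apply/orP; left; apply/eqP; ring.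
apply/funext; elim=> [|n IH]; first by rewrite lprod0 [series _ _]big_geq // add0r.
by rewrite lprodS seriesSr addrAC -IH mulrBr mulr1 addrC subrK.
Qed.

End BanachSequences.

(** A product growing on the left is one growing on the right in the opposite algebra, which has the
    same norm. *)
Lemma rprod_cvg (K : realType) (V : banachAlgType K) (F : nat -> V) (s q : K) :
  0 <= s -> 0 <= q < 1 ->
  (forall j, `|F j - 1| <= s * q ^+ j) -> cvgn (rprod F).
Proof.
move=> s0 q01 Fs; have := @lprod_cvg K (banach_op V) F s q s0 q01 Fs.
by rewrite op_lprod.
Qed.

(** * Factors that tend to 1 geometrically *)

Definition qratio (V : unitRingType) (u v Q : V) (j : nat) : V :=
  (1 - u * Q ^+ j) * (1 - v * Q ^+ j)^-1.

Section GeometricFactors.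
Variables (K : realType) (V : banachAlgType K).
Implicit Types u v x y Q : V.

Lemma norm_mulX y x n : `|y * x ^+ n| <= `|y| * `|x| ^+ n.
Proof.
elim: n => [|n IH]; first by rewrite !expr0 !mulr1.
rewrite !exprSr !mulrA; apply: le_trans (banach_normrM _ _) _.
by rewrite ler_wpM2r.
Qed.

Lemma norm_mulX_le y x n : `|x| < 1 -> `|y * x ^+ n| <= `|y|.
Proof.
move=> x1; apply: le_trans (norm_mulX _ _ _) _.
by rewrite ler_piMr // exprn_ile1 // ltW.
Qed.

Lemma cvg_mulX y x : `|x| < 1 -> (fun n => y * x ^+ n) @ \oo --> 0.
Proof.
move=> x1; apply: (norm_le_cvg0 (norm_mulX y x)).
by have := @cvg_geometric K `|y| `|x|; rewrite normr_id; apply.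
Qed.

Lemma neumann x : `|x| < 1 -> 1 - x \is a GRing.unit.
Proof.
move=> x1.
have bnd k : `|x ^+ k| <= `|1 : V| * `|x| ^+ k by rewrite -[x ^+ k]mul1r norm_mulX.
have xr : 0 <= `|x| < 1 by rewrite normr_ge0.
have cs : series (fun k => x ^+ k) @ \oo --> limn (series (fun k => x ^+ k)).
  exact: (@geo_cvg_series K V _ _ _ xr (normr_ge0 _) bnd).
have lim1 : (fun n => 1 - x ^+ n) @ \oo --> (1 : V).
  rewrite -[X in _ --> X]subr0; apply: cvgB; first exact: cvg_cst.
  apply: (norm_le_cvg0 bnd).
  by have := @cvg_geometric K `|1 : V| `|x|; rewrite normr_id; apply.
have telel n : (1 - x) * series (fun k => x ^+ k) n = 1 - x ^+ n.
  elim: n => [|n IH]; first by rewrite [series _ _]big_geq // mulr0 expr0 subrr.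
  by rewrite seriesSr mulrDr IH mulrBl mul1r -exprS addrA subrK.
have teler n : series (fun k => x ^+ k) n * (1 - x) = 1 - x ^+ n.
  elim: n => [|n IH]; first by rewrite [series _ _]big_geq // mul0r expr0 subrr.
  by rewrite seriesSr mulrDl IH mulrBr mulr1 -exprSr addrA subrK.
apply/unitrP; exists (limn (series (fun k => x ^+ k))); split.
- have := banach_cvgM cs (cvg_cst (1 - x)); rewrite (funext teler) => lim2.
  exact: (cvg_unique (@norm_hausdorff K V) (lim2 _) lim1).
- have := banach_cvgM (cvg_cst (1 - x)) cs; rewrite (funext telel) => lim2.
  exact: (cvg_unique (@norm_hausdorff K V) (lim2 _) lim1).
Qed.

(** The inverse y satisfies y = 1 + y v Q^j, so it is enough to bound y. Once |v| |Q|^j <= 1/2 this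
    equation gives |y| <= 2 |1|; the finitely many earlier inverses are bounded by their sum. *)
Lemma inv1B_geo v Q : `|Q| < 1 ->
  (forall j, 1 - v * Q ^+ j \is a GRing.unit) ->
  exists2 s, 0 <= s & forall j, `|(1 - v * Q ^+ j)^-1 - 1| <= s * `|Q| ^+ j.
Proof.
move=> Q1 vU; pose y j := (1 - v * Q ^+ j)^-1.
have yE j : y j = 1 + y j * v * Q ^+ j.
  by have := mulVr (vU j); rewrite -/(y j) mulrBr mulr1 mulrA => <-; rewrite subrK.
have [N _ HN] : \forall j \near \oo, `|v| * `|Q| ^+ j <= 1 / 2.
  have lim0 : (fun j => `|v| * `|Q| ^+ j) @ \oo --> 0.
    by have := @cvg_geometric K `|v| `|Q|; rewrite normr_id; apply.
  by apply: (cvgr_le _ lim0); rewrite divr_gt0.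
pose Y := 2 * `|1 : V| + \sum_(j < N) `|y j|.
have S0 : 0 <= \sum_(j < N) `|y j| by apply: sumr_ge0.
have yY j : `|y j| <= Y.
  have [Nj|jN] := leqP N j; last first.
    rewrite /Y (bigD1 (Ordinal jN)) //= addrCA lerDl.
    by rewrite addr_ge0 ?mulr_ge0 // sumr_ge0.
  apply: le_trans (_ : 2 * `|1 : V| <= _); last by rewrite /Y lerDl.
  have h : `|y j| <= `|1 : V| + `|y j| * (1 / 2).
    rewrite {1}yE; apply: le_trans (ler_normD _ _) _; rewrite lerD2l -mulrA.
    apply: le_trans (banach_normrM _ _) _; rewrite ler_wpM2l //.
    by apply: le_trans (norm_mulX _ _ _) _; exact: HN.
  by move: h; set t := `|y j|; set w := `|1 : V|; lra.
exists (Y * `|v|).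
  by rewrite mulr_ge0 //; apply: le_trans (yY 0%N).
move=> j; rewrite -/(y j) yE addrC addKr -[_ * v * _]mulrA -mulrA.
apply: le_trans (banach_normrM _ _) _.
by apply: ler_pM => //; exact: norm_mulX.
Qed.

Lemma qratio_geo u v Q : `|Q| < 1 ->
  (forall j, 1 - v * Q ^+ j \is a GRing.unit) ->
  exists2 s, 0 <= s & forall j, `|qratio u v Q j - 1| <= s * `|Q| ^+ j.
Proof.
move=> Q1 vU; have [s s0 Hs] := inv1B_geo Q1 vU.
exists (s + `|u| * (`|1 : V| + s)); first by rewrite addr_ge0 // mulr_ge0 // addr_ge0.
move=> j; rewrite /qratio; set y := (_)^-1.
have ys : `|y - 1| <= s * `|Q| ^+ j by exact: Hs.
have -> : (1 - u * Q ^+ j) * y - 1 = (y - 1) - u * Q ^+ j * y.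
  by rewrite mulrBl mul1r addrAC.
apply: le_trans (ler_normB _ _) _; rewrite mulrDl; apply: lerD => //.
apply: le_trans (banach_normrM _ _) _; rewrite mulrAC.
apply: ler_pM => //; first exact: norm_mulX.
rewrite -[y](subrK 1) addrC; apply: le_trans (ler_normD _ _) _; rewrite lerD2l.
by apply: le_trans ys _; rewrite ler_piMr // exprn_ile1 // ltW.
Qed.

Lemma lprod_qratio_cvg u v Q : `|Q| < 1 ->
  (forall j, 1 - v * Q ^+ j \is a GRing.unit) -> cvgn (lprod (qratio u v Q)).
Proof.
move=> Q1 vU; have [s s0 Hs] := qratio_geo u Q1 vU.
by apply: lprod_cvg Hs => //; rewrite normr_ge0.
Qed.

Lemma rprod_qratio_cvg u v Q : `|Q| < 1 ->
  (forall j, 1 - v * Q ^+ j \is a GRing.unit) -> cvgn (rprod (qratio u v Q)).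
Proof.
move=> Q1 vU; have [s s0 Hs] := qratio_geo u Q1 vU.
by apply: rprod_cvg Hs => //; rewrite normr_ge0.
Qed.

End GeometricFactors.

(** * The contiguous relation and the q-binomial recurrence *)

(** The right argument is decomposed first; a compound left argument is swapped to the right only
    when the right one is atomic, so the search does not cycle. The remaining pairs of atoms are
    looked up among the hypotheses. *)
Ltac comm := repeat match goal with
  | |- GRing.comm ?x ?x => reflexivity
  | H : GRing.comm ?x ?y |- GRing.comm ?x ?y => exact H
  | H : GRing.comm ?y ?x |- GRing.comm ?x ?y => exact (commr_sym H)
  | |- GRing.comm _ (_ * _) => apply: commrM
  | |- GRing.comm _ (_ + _) => apply: commrD
  | |- GRing.comm _ (- _) => apply: commrN
  | |- GRing.comm _ (_ ^+ _) => apply: commrX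
  | |- GRing.comm _ _^-1 => apply: commrV
  | |- GRing.comm _ 1 => exact: commr1
  | |- GRing.comm _ 0 => exact: commr0
  | |- GRing.comm _ (lprod _ _) => apply: commr_lprod; intro
  | |- GRing.comm (_ * _) _ => apply: commr_sym
  | |- GRing.comm (_ + _) _ => apply: commr_sym
  | |- GRing.comm (- _) _ => apply: commr_sym
  | |- GRing.comm (_ ^+ _) _ => apply: commr_sym
  | |- GRing.comm _^-1 _ => apply: commr_sym
  | |- GRing.comm 1 _ => apply: commr_sym
  | |- GRing.comm 0 _ => apply: commr_sym
  | |- GRing.comm (lprod _ _) _ => apply: commr_sym
  end.

Section Terms.
Variable V : unitRingType.
Implicit Types a c : V.
Variables B C Q : V.

(* The terms of index k and -k of the bilateral series with a = A^-1.  Neither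
   needs a to be invertible, so that a = 0 is allowed. *)
Definition pos_term a (k : nat) : V :=
  lprod (fun i => (a - Q ^+ i) * C * (1 - B * Q ^+ i)^-1) k.

Definition neg_term a c (k : nat) : V :=
  lprod (fun i => (B - Q ^+ i.+1) * c * (1 - a * Q ^+ i.+1)^-1) k.

Hypotheses (QB : GRing.comm Q B) (QC : GRing.comm Q C).

Section Shift.
Variable a : V.
Hypotheses (aQ : GRing.comm a Q) (aB : GRing.comm a B) (aC : GRing.comm a C).

Lemma pos_termE k : pos_term a k =
  lprod (fun i => a - Q ^+ i) k * lprod (fun i => C * (1 - B * Q ^+ i)^-1) k.
Proof.
rewrite -lprodM; last by move=> i j; comm.
by apply: eq_lprod => i; rewrite mulrA.
Qed.

Lemma neg_termE c k : GRing.comm a c -> GRing.comm Q c -> neg_term a c k =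
  lprod (fun i => (B - Q ^+ i.+1) * c) k * lprod (fun i => (1 - a * Q ^+ i.+1)^-1) k.
Proof. by move=> ac Qc; rewrite -lprodM // => i j; comm. Qed.

End Shift.

(** For i > 0, a Q - Q^i = Q (a - Q^(i-1)), so the scalar factors of a Q are those of a moved by
    one, times Q^k; the factor i = 0 gives -(1 - a Q). *)
Lemma pos_term_shift a k :
  GRing.comm a Q -> GRing.comm a B -> GRing.comm a C ->
  pos_term (a * Q) k.+1 =
  - ((1 - a * Q) * Q ^+ k) * (pos_term a k * C * (1 - B * Q ^+ k)^-1).
Proof.
move=> aQ aB aC; rewrite !pos_termE; [|comm..].
rewrite lprodSl lprodS expr0.
have -> : a * Q - 1 = - (1 - a * Q) by rewrite opprB.
rewrite !mulNr -!mulrA; congr (- (_ * _)).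
rewrite [in LHS](@eq_lprod _ _ (fun i => Q * (a - Q ^+ i))); last first.
  by move=> i; rewrite mulrBr -exprS aQ.
rewrite lprodM; last by move=> i j; comm.
by rewrite {1}/lprod prodr_const card_ord -!mulrA.
Qed.

(** Replacing a by a Q moves the denominators by one place, so all but the first and the last
    cancel. *)
Lemma neg_term_shift a c k :
  GRing.comm a Q -> GRing.comm a B -> GRing.comm a c -> GRing.comm Q c ->
  (forall i, 1 - a * Q ^+ i.+1 \is a GRing.unit) ->
  neg_term (a * Q) c k = neg_term a c k * ((1 - a * Q) * (1 - a * Q ^+ k.+1)^-1).
Proof.
move=> aQ aB ac Qc aU; rewrite !neg_termE; [|comm..].
rewrite -mulrA; congr (_ * _).
set e := lprod (fun i => (1 - a * Q ^+ i.+1)^-1).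
have -> : e k * ((1 - a * Q) * (1 - a * Q ^+ k.+1)^-1) = (1 - a * Q) * e k.+1.
  rewrite /e lprodS !mulrA; congr (_ * _).
  by have : GRing.comm (1 - a * Q) (e k) by rewrite /e; comm.
rewrite /e lprodSl expr1 mulVKr; last by have := aU 0; rewrite expr1.
by apply: eq_lprod => i; rewrite -mulrA -exprS.
Qed.

Lemma contiguous_identity a q s x :
  GRing.comm a x -> GRing.comm q x -> GRing.comm s x -> GRing.comm a q ->
  GRing.comm a s -> GRing.comm q s -> GRing.comm a B -> GRing.comm q B ->
  GRing.comm s B ->
  - (s * q) * x * (1 - a * B) = ((a - q) * x - a * (x * (1 - B * q))) * s.
Proof.
move=> ax qx sx aq as_ qs aB qB sB.
have -> : x * (1 - B * q) = x - q * (x * B).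
  by rewrite mulrBr mulr1 -qB !mulrA -qx.
have -> : (a - q) * x - a * (x - q * (x * B)) = - (q * (x * (1 - a * B))).
  have -> : q * (x * (1 - a * B)) = q * x - a * (q * (x * B)).
    by rewrite mulrBr mulr1 mulrBr !mulrA -[q * x * a]mulrA -ax mulrA aq.
  by rewrite mulrBl mulrBr !opprB addrC subrKA.
have : GRing.comm s (q * (x * (1 - a * B))) by comm.
by rewrite !mulNr => <-; rewrite !mulrA.
Qed.

(** With T_k(a) the term of integer index k, the relation is T_k(a Q) (1 - a B) = (T_k(a) -
    T_(k-1)(a) a C) (1 - a Q), here for k > 0. All terms are written through x = p C D, and the two
    summands a x cancel. *)
Lemma pos_contiguous a k :
  GRing.comm a Q -> GRing.comm a B -> GRing.comm a C ->
  (forall i, 1 - B * Q ^+ i \is a GRing.unit) ->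
  pos_term (a * Q) k.+1 * (1 - a * B) =
  (pos_term a k.+1 - pos_term a k * (a * C)) * (1 - a * Q).
Proof.
move=> aQ aB aC BU; rewrite pos_term_shift // [in RHS]/pos_term lprodS.
rewrite -/(pos_term a k); set q := Q ^+ k; set p := pos_term a k.
set D := (1 - B * q)^-1; set s := 1 - a * Q.
have ap : GRing.comm a p by rewrite /p /pos_term; comm.
have qp : GRing.comm q p by rewrite /p /q /pos_term; comm.
set x := p * C * D.
have sx : GRing.comm s x by rewrite /s /x /D /q /p /pos_term; comm.
have ax : GRing.comm a x by rewrite /x /D /q; comm.
have qx : GRing.comm q x by rewrite /x /D /q /p /pos_term; comm.
have -> : p * ((a - q) * C * D) = (a - q) * x.
  rewrite /x !mulrA; congr (_ * _ * _).
  by rewrite mulrBr mulrBl ap qp.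
have -> : p * (a * C) = a * (x * (1 - B * q)).
  by rewrite /x /D mulrVK ?BU // !mulrA ap.
apply: contiguous_identity => //; rewrite /s /q; comm.
Qed.

(** The same relation at index -k. Here [c * C = 1] undoes the last c, and the bracket collapses to
    the term of index -k times (1 - a B) (1 - a Q^(k+1))^-1, which is what [neg_term_shift]
    produces. *)
Lemma neg_contiguous a c k :
  GRing.comm a Q -> GRing.comm a B -> GRing.comm a C -> GRing.comm a c ->
  GRing.comm Q c -> c * C = 1 ->
  (forall i, 1 - a * Q ^+ i.+1 \is a GRing.unit) ->
  neg_term (a * Q) c k * (1 - a * B) =
  (neg_term a c k - neg_term a c k.+1 * (a * C)) * (1 - a * Q).
Proof.
move=> aQ aB aC ac Qc cC aU; rewrite neg_term_shift // [in RHS]/neg_term lprodS.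
rewrite -/(neg_term a c k); move: (neg_term a c k) => n.
have := aU k; set r := Q ^+ k.+1 => rU.
have ar : GRing.comm a r by rewrite /r; comm.
have rB : GRing.comm r B by rewrite /r; comm.
have rC : GRing.comm r C by rewrite /r; comm.
have Qr : GRing.comm Q r by rewrite /r; comm.
set F := (1 - a * r)^-1.
have FaC : GRing.comm F (a * C) by rewrite /F; comm.
rewrite -[in RHS](mulrA n).
have -> : (B - r) * c * F * (a * C) = (B - r) * a * F.
  by rewrite -mulrA FaC -(mulrA _ c) (mulrA c) (mulrA c a) -ac -(mulrA a c) cC mulr1
    !mulrA.
have -> : n - n * ((B - r) * a * F) = n * ((1 - a * B) * F).
  rewrite -[X in X - _]mulr1 -mulrBr; congr (_ * _).
  apply: (mulIr rU); rewrite mulrBl mul1r !mulrVK //.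
  by rewrite mulrBl aB -ar opprB addrA subrK.
have FaB : GRing.comm ((1 - a * B) * F) (1 - a * Q) by rewrite /F; comm.
have Fb : GRing.comm F (1 - a * B) by rewrite /F; comm.
by rewrite -!mulrA; congr (n * _); rewrite Fb [RHS]mulrA FaB.
Qed.

(** The sum of the termwise relations over -n <= k <= n; the lowered index ranges over -n-1 <= k <=
    n-1, hence the crossed lengths on the right. *)
Lemma contiguous_partial a c n :
  GRing.comm a Q -> GRing.comm a B -> GRing.comm a C -> GRing.comm a c ->
  GRing.comm Q c -> c * C = 1 ->
  (forall i, 1 - B * Q ^+ i \is a GRing.unit) ->
  (forall i, 1 - a * Q ^+ i.+1 \is a GRing.unit) ->
  let pos a := series (pos_term a) in
  let neg a := series (fun k => neg_term a c k.+1) in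
  (pos (a * Q) n.+1 + neg (a * Q) n) * (1 - a * B) =
  (pos a n.+1 + neg a n - (pos a n + neg a n.+1) * (a * C)) * (1 - a * Q).
Proof.
move=> aQ aB aC ac Qc cC BU aU /=.
elim: n => [|n IH].
  (* The relation at index 0 belongs to the negative side, since it involves the term of index
     -1. *)
  have := neg_contiguous 0 aQ aB aC ac Qc cC aU.
  rewrite /series /= !big_nat1 !big_geq // !addr0 add0r.
  by rewrite /pos_term /neg_term !lprod0.
have hp := pos_contiguous n aQ aB aC BU.
have hn := neg_contiguous n.+1 aQ aB aC ac Qc cC aU.
rewrite [series _ n.+2]seriesSr [series (fun k => neg_term (a * Q) _ _) n.+1]seriesSr.
rewrite addrACA mulrDl IH [X in _ + X = _]mulrDl hp hn -!mulrDl; congr (_ * _).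
rewrite [in RHS](seriesSr _ n.+1) [X in _ = _ + X - _]seriesSr.
rewrite [X in _ = _ - (_ + X) * _]seriesSr [X in _ = _ - (X + _) * _]seriesSr.
rewrite [in RHS]addrACA [X in _ = _ - X * _]addrACA [in RHS]mulrDl opprD [RHS]addrACA.
by congr (_ + _); rewrite mulrDl opprD addrACA.
Qed.

Lemma neg_term_scale c k : GRing.comm Q c ->
  neg_term 1 (c * Q) k = neg_term 1 c k * Q ^+ k.
Proof.
move=> Qc; elim: k => [|k IH]; first by rewrite /neg_term !lprod0 mulr1.
rewrite /neg_term lprodS -/(neg_term 1 (c * Q) k) IH [in RHS]lprodS.
rewrite -/(neg_term 1 c k) -!mulrA; congr (_ * _).
set b := B - _; set F := _^-1.
have kb : GRing.comm (Q ^+ k) b by rewrite /b; comm.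
have kc : GRing.comm (Q ^+ k) c by comm.
have kF : GRing.comm (Q ^+ k.+1) F by rewrite /F; comm.
rewrite (mulrA _ b) kb -(mulrA b); congr (_ * _); rewrite (mulrA _ c) kc -(mulrA c).
by congr (_ * _); rewrite mulrA -exprSr kF.
Qed.

(** With t_k the terms at c, [neg_term_scale] turns the difference of terms into t_k (1 - Q^k). For
    index k + 1 this factor cancels the last denominator and leaves t_k (B - Q^(k+1)) c, where t_k
    Q^k is again the term at c Q. *)
Lemma q_binomial_partial c n : GRing.comm Q c ->
  (forall i, 1 - Q ^+ i.+1 \is a GRing.unit) ->
  let S c := series (neg_term 1 c) in
  S c n.+1 - S (c * Q) n.+1 = S c n * (B * c) - S (c * Q) n * (Q * c).
Proof.
move=> Qc QU /=.
have step k : neg_term 1 c k.+1 - neg_term 1 (c * Q) k.+1 =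
    neg_term 1 c k * (B * c) - neg_term 1 (c * Q) k * (Q * c).
  rewrite !neg_term_scale // -[X in X - _]mulr1 -mulrBr.
  rewrite [in LHS]/neg_term lprodS -/(neg_term 1 c k) mul1r -!mulrA mulVr //.
  rewrite mulr1 -mulrBr; congr (_ * _).
  by rewrite mulrBl exprSr mulrA.
elim: n => [|n IH].
  by rewrite /series /= !big_nat1 !big_geq // !mul0r /neg_term !lprod0 !subrr.
rewrite [in LHS]seriesSr [X in _ - X = _]seriesSr opprD addrACA IH step.
rewrite [X in _ = X * _ - _]seriesSr [X in _ = _ - X * _]seriesSr.
by rewrite [in RHS]mulrDl [X in _ = _ - X]mulrDl opprD [RHS]addrACA.
Qed.

End Terms.

(** * The product formula *)

Section Core.
Variables (K : realType) (V : banachAlgType K).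
Variables B C c Q : V.
Hypotheses (Q_lt1 : `|Q| < 1) (Bc_lt1 : `|B * c| < 1).
Hypotheses (Cc : C * c = 1) (cC : c * C = 1).
Hypotheses (QB : GRing.comm Q B) (QC : GRing.comm Q C).
Hypothesis BU : forall i, 1 - B * Q ^+ i \is a GRing.unit.

Local Notation pos := (pos_term B C Q).
Local Notation neg := (neg_term B Q).

Lemma comm_c x : GRing.comm x C -> GRing.comm x c.
Proof.
move=> xC; rewrite /GRing.comm -[LHS]mul1r -{1}cC -mulrA (mulrA C) -xC.
by rewrite -(mulrA x) Cc mulr1.
Qed.

Let Qc : GRing.comm Q c := comm_c QC.

Definition bisum (a : V) : V :=
  limn (series (pos a)) + limn (series (fun k => neg a c k.+1)).

(** The exponent starts at 1, so that a = 1 qualifies although 1 - a is then 0. *)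
Definition admissible (a : V) : Prop :=
  [/\ GRing.comm a Q, GRing.comm a B, GRing.comm a C &
      forall i, 1 - a * Q ^+ i.+1 \is a GRing.unit].

Lemma admissibleX a n : admissible a -> admissible (a * Q ^+ n).
Proof.
move=> [aQ aB aC aU]; split; [by comm..|] => i.
by rewrite -mulrA -exprD addnS.
Qed.

Lemma admissible1 : admissible 1.
Proof.
split; [by comm..|] => i; rewrite mul1r exprS; apply: neumann.
by apply: le_lt_trans (norm_mulX_le _ _ Q_lt1) _.
Qed.

(** One estimate, read at index j + n, serves twice: it bounds the factors uniformly in n and shows
    that each of them tends to 1 as n grows. *)
Lemma inv1B_shift_geo a : admissible a ->
  exists2 s, 0 <= s & forall n j,
    `|(1 - a * Q ^+ n * Q ^+ j.+1)^-1 - 1| <= s * `|Q| ^+ j * `|Q| ^+ n.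
Proof.
move=> [_ _ _ aU].
have [j|s s0 Hs] := @inv1B_geo K V (a * Q) Q Q_lt1; first by rewrite -mulrA -exprS.
exists s => // n j.
have -> : a * Q ^+ n * Q ^+ j.+1 = a * Q * Q ^+ (j + n).
  by rewrite -!mulrA -exprD -exprS addnS addnC.
by rewrite -[leRHS]mulrA -exprD.
Qed.

(** The j-th factor is B c up to a relative and an additive error of order |Q|^j, uniformly in n.
    The midpoint r of |B c| and 1 leaves room for these errors. *)
Lemma neg_bound a : admissible a -> exists M r,
  [/\ 0 <= M, 0 <= r < 1 & forall n k, `|neg (a * Q ^+ n) c k| <= M * r ^+ k].
Proof.
move=> ad; have [s s0 Hs] := inv1B_shift_geo ad.
pose r := (`|B * c| + 1) / 2.
have r1 : r < 1 by move: Bc_lt1; rewrite /r; lra.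
have r0 : 0 <= r by rewrite divr_ge0 // addr_ge0.
have wr : 0 <= `|B * c| < r by rewrite normr_ge0 /=; move: Bc_lt1; rewrite /r; lra.
have q01 : 0 <= `|Q| < 1 by rewrite normr_ge0.
have [M M0 HM] := prod_perturbed_le_geo wr (normr_ge0 c) s0 q01.
exists (`|1 : V| * M), r; split; rewrite ?mulr_ge0 ?r0 // => n k.
have Hj j : `|(B - Q ^+ j.+1) * c * (1 - a * Q ^+ n * Q ^+ j.+1)^-1| <=
    (`|B * c| + `|c| * `|Q| ^+ j) * (1 + s * `|Q| ^+ j).
  have yn : `|(1 - a * Q ^+ n * Q ^+ j.+1)^-1 - 1| <= s * `|Q| ^+ j.
    apply: le_trans (Hs n j) _; rewrite ler_piMr ?exprn_ile1 ?mulr_ge0 ?exprn_ge0 //.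
    exact: ltW.
  apply: le_trans (norm_mul1D _ yn) _.
  rewrite ler_wpM2r ?addr_ge0 ?mulr_ge0 ?exprn_ge0 //.
  rewrite mulrBl; apply: le_trans (ler_normB _ _) _; rewrite lerD2l.
  have -> : Q ^+ j.+1 * c = c * Q ^+ j.+1 by apply: commr_sym; comm.
  apply: le_trans (norm_mulX _ _ _) _; rewrite ler_wpM2l // exprS.
  by rewrite ler_piMl ?exprn_ge0 // ltW.
apply: le_trans (norm_lprod_le Hj k) _.
by rewrite -mulrA ler_wpM2l //; exact: HM.
Qed.

Lemma pos_bound a : GRing.comm a Q -> `|a * C| < 1 -> exists M r,
  [/\ 0 <= M, 0 <= r < 1 & forall n k, `|pos (a * Q ^+ n) k| <= M * r ^+ k].
Proof.
move=> aQ aC1; have [s s0 Hs] := inv1B_geo Q_lt1 BU.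
pose r := (`|a * C| + 1) / 2.
have r1 : r < 1 by move: aC1; rewrite /r; lra.
have r0 : 0 <= r by rewrite divr_ge0 // addr_ge0.
have wr : 0 <= `|a * C| < r by rewrite normr_ge0 /=; move: aC1; rewrite /r; lra.
have q01 : 0 <= `|Q| < 1 by rewrite normr_ge0.
have [M M0 HM] := prod_perturbed_le_geo wr (normr_ge0 C) s0 q01.
exists (`|1 : V| * M), r; split; rewrite ?mulr_ge0 ?r0 // => n k.
have Hj j : `|(a * Q ^+ n - Q ^+ j) * C * (1 - B * Q ^+ j)^-1| <=
    (`|a * C| + `|C| * `|Q| ^+ j) * (1 + s * `|Q| ^+ j).
  apply: le_trans (norm_mul1D _ (Hs j)) _.
  rewrite ler_wpM2r ?addr_ge0 ?mulr_ge0 ?exprn_ge0 //.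
  have -> : (a * Q ^+ n - Q ^+ j) * C = a * C * Q ^+ n - C * Q ^+ j.
    have CQ m : Q ^+ m * C = C * Q ^+ m by apply: commr_sym; comm.
    by rewrite mulrBl -[in LHS](mulrA a) !CQ (mulrA a).
  apply: le_trans (ler_normB _ _) _; apply: lerD; last exact: norm_mulX.
  exact: norm_mulX_le.
apply: le_trans (norm_lprod_le Hj k) _.
by rewrite -mulrA ler_wpM2l //; exact: HM.
Qed.

Lemma neg_cvg a : admissible a -> cvgn (series (fun k => neg a c k.+1)).
Proof.
move=> /neg_bound [M [r [M0 r01 H]]].
apply: (@geo_cvg_series K V _ (M * r) r) => //.
  by rewrite mulr_ge0 //; case/andP: r01.
by move=> k; have := H 0%N k.+1; rewrite expr0 mulr1 exprS mulrA.
Qed.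

Lemma pos_cvg a : GRing.comm a Q -> `|a * C| < 1 -> cvgn (series (pos a)).
Proof.
move=> aQ /(pos_bound aQ) [M [r [M0 r01 H]]].
apply: (@geo_cvg_series K V _ M r) => // k.
by have := H 0%N k; rewrite expr0 mulr1.
Qed.

(** Dominated convergence on each half of the series; at a = 0 the denominators of the negative
    terms are 1. *)
Lemma bisum_cvg a : admissible a -> `|a * C| < 1 ->
  (fun n => bisum (a * Q ^+ n)) @ \oo --> bisum 0.
Proof.
move=> ad aC1; have [aQ _ _ aU] := ad.
have a0 : (fun n => a * Q ^+ n) @ \oo --> 0 := cvg_mulX a Q_lt1.
apply: cvgD.
  have [M [r [M0 r01 H]]] := pos_bound aQ aC1.
  apply: (tannery r01 M0 H) => k; apply: cvg_lprod => i.
  apply: banach_cvgM; last exact: cvg_cst.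
  apply: banach_cvgM; last exact: cvg_cst.
  by apply: cvgB => //; exact: cvg_cst.
have [M [r [M0 r01 H]]] := neg_bound ad.
have H' n k : `|neg (a * Q ^+ n) c k.+1| <= M * r * r ^+ k.
  by rewrite -mulrA -exprS.
have Mr0 : 0 <= M * r by rewrite mulr_ge0 //; case/andP: r01.
apply: (tannery r01 Mr0 H') => k; apply: cvg_lprod => i.
apply: banach_cvgM; first exact: cvg_cst.
rewrite mul0r subr0 invr1; apply/(subr_cvg0 _ (1 : V)).
have [s s0 Hs] := inv1B_shift_geo ad.
apply: (norm_le_cvg0 (Hs ^~ i)).
have := @cvg_geometric K (s * `|Q| ^+ i) `|Q|; rewrite normr_id; exact.
Qed.

(** Convergence of the positive halves is assumed in place of |a C| < 1, so that the relation also
    covers the terminating case a = Q^n. *)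
Lemma bisum_contiguous a : admissible a -> cvgn (series (pos a)) ->
  cvgn (series (pos (a * Q))) ->
  bisum (a * Q) * (1 - a * B) = bisum a * (1 - a * C) * (1 - a * Q).
Proof.
move=> ad cp cp'; have cn := neg_cvg ad.
have cn' : cvgn (series (fun k => neg (a * Q) c k.+1)).
  by apply: neg_cvg; have := admissibleX 1 ad; rewrite expr1.
have [aQ aB aC aU] := ad.
have lhs : (fun n => (series (pos (a * Q)) n.+1 +
      series (fun k => neg (a * Q) c k.+1) n) * (1 - a * B)) @ \oo -->
    bisum (a * Q) * (1 - a * B).
  by apply: banach_cvgM; [apply: cvgD => //; exact: cvg_seriesS | exact: cvg_cst].
have rhs : (fun n => (series (pos a) n.+1 + series (fun k => neg a c k.+1) n -
      (series (pos a) n + series (fun k => neg a c k.+1) n.+1) * (a * C)) *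
      (1 - a * Q)) @ \oo -->
    (bisum a - bisum a * (a * C)) * (1 - a * Q).
  apply: banach_cvgM; last exact: cvg_cst.
  apply: cvgB; first by apply: cvgD => //; exact: cvg_seriesS.
  apply: banach_cvgM; last exact: cvg_cst.
  by apply: cvgD => //; exact: (@cvg_seriesS K V (fun k => neg a c k.+1)).
have -> : bisum a * (1 - a * C) = bisum a - bisum a * (a * C).
  by rewrite mulrBr mulr1.
have E n := contiguous_partial QB QC n aQ aB aC (comm_c aC) Qc cC BU aU.
rewrite /= in E; rewrite (funext E) in lhs.
exact: (cvg_unique (@norm_hausdorff K V) lhs rhs).
Qed.

Lemma pos_termX_eq0 n k : (n < k)%N -> pos (Q ^+ n) k = 0.
Proof.
elim: k => // k IH; rewrite ltnS leq_eqVlt => /orP [/eqP <-|/IH p0].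
  by rewrite /pos_term lprodS subrr !mul0r mulr0.
by rewrite /pos_term lprodS -/(pos_term _ _ _ _ _) p0 mul0r.
Qed.

Lemma series_posX n k : series (pos (Q ^+ n)) (k + n.+1)%N = series (pos (Q ^+ n)) n.+1.
Proof.
elim: k => // k IH.
by rewrite addSn seriesSr IH pos_termX_eq0 ?addr0 // leq_addl.
Qed.

Lemma posX_cvg n : series (pos (Q ^+ n)) @ \oo --> series (pos (Q ^+ n)) n.+1.
Proof.
rewrite -(cvg_shiftn n.+1) /= (funext (series_posX n)); exact: cvg_cst.
Qed.

(** Each step expresses the sum at a Q^n through the one at a Q^(n+1), so the new factor lands to
    the left of the old ones. The parts 1 - a Q^(n+1) commute with everything and are collected
    separately. *)
Lemma bisum_rprod a n : admissible a -> `|a * C| < 1 ->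
  bisum a = bisum (a * Q ^+ n) *
    (rprod (qratio (a * B) (a * C) Q) n * lprod (qratio 0 (a * Q) Q) n).
Proof.
move=> ad aC1; elim: n => [|n IH]; first by rewrite rprod0 lprod0 expr0 !mulr1.
have adn := admissibleX n ad; have [aQ aB aC aU] := ad; have [anQ anB anC anU] := adn.
have lt1 m : `|a * Q ^+ m * C| < 1.
  have -> : a * Q ^+ m * C = a * C * Q ^+ m.
    by rewrite -!mulrA; congr (_ * _); apply: commr_sym; comm.
  by apply: le_lt_trans (norm_mulX_le _ _ Q_lt1) _.
have cr := bisum_contiguous adn (pos_cvg anQ (lt1 n)).
rewrite -mulrA -exprSr in cr.
have anQ' : GRing.comm (a * Q ^+ n.+1) Q by comm.
have {cr} := cr (pos_cvg anQ' (lt1 n.+1)).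
set f := qratio (a * B) (a * C) Q; set g := qratio 0 (a * Q) Q => cr.
have un := neumann (lt1 n); have un1 := anU 0%N; rewrite expr1 -mulrA -exprSr in un1.
have fE : f n = (1 - a * Q ^+ n * B) * (1 - a * Q ^+ n * C)^-1.
  rewrite /f /qratio -!mulrA.
  have -> : B * Q ^+ n = Q ^+ n * B by apply: commr_sym; comm.
  by have -> : C * Q ^+ n = Q ^+ n * C by apply: commr_sym; comm.
have gE : g n = (1 - a * Q ^+ n.+1)^-1.
  by rewrite /g /qratio mul0r subr0 mul1r -!mulrA -exprS.
have fg : GRing.comm (g n) (rprod f n).
  by apply: commr_rprod => i; rewrite gE /f /qratio; comm.
have gg : GRing.comm (g n) (lprod g n).
  by rewrite gE /g /qratio; comm.
rewrite IH rprodS lprodS.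
have -> : bisum (a * Q ^+ n) = bisum (a * Q ^+ n.+1) * (f n * g n).
  have h : GRing.comm (1 - a * Q ^+ n.+1) (1 - a * Q ^+ n * C)^-1 by comm.
  by rewrite fE gE !mulrA cr -(mulrA _ (1 - a * Q ^+ n.+1)) h !mulrA !mulrK.
rewrite -mulrA; congr (_ * _); exact: mulr_comm_interchange.
Qed.

Lemma admissible_exp n : admissible (Q ^+ n).
Proof. by have := admissibleX n admissible1; rewrite mul1r. Qed.

(** Each step goes forward from Q^n to Q^(n+1) by dividing by 1 - B Q^n on the right; 1 - C Q^n is
    never inverted. *)
Lemma bisum_lprod n :
  bisum (Q ^+ n) = bisum 1 * (lprod (qratio C B Q) n * lprod (qratio Q 0 Q) n).
Proof.
elim: n => [|n IH]; first by rewrite !lprod0 expr0 !mulr1.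
have adn := admissible_exp n; have [nQ nB nC nU] := adn.
have pcvg m : cvgn (series (pos (Q ^+ m))) := cvgP _ (@posX_cvg m).
have := bisum_contiguous adn (pcvg n).
rewrite -exprSr => /(_ (pcvg n.+1)).
have -> : Q ^+ n * B = B * Q ^+ n by apply: commr_sym; comm.
have -> : Q ^+ n * C = C * Q ^+ n by apply: commr_sym; comm.
set f := qratio C B Q; set g := qratio Q 0 Q => cr.
have gE : g n = 1 - Q ^+ n.+1 by rewrite /g /qratio mul0r subr0 invr1 mulr1 -exprS.
have gf i : GRing.comm (g n) (f i) by rewrite gE /f /qratio; comm.
have gg : GRing.comm (g n) (lprod g n) by rewrite gE /g /qratio; comm.
have gC : GRing.comm (1 - C * Q ^+ n) (g n) by rewrite gE; comm.
have fG : GRing.comm (f n) (lprod g n).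
  by apply: commr_lprod => i; rewrite /g /qratio mul0r subr0 invr1 mulr1 /f /qratio; comm.
have fE : f n * (1 - B * Q ^+ n) = 1 - C * Q ^+ n by rewrite mulrVK.
apply: (mulIr (BU n)); rewrite cr !lprodS mulr_comm_interchange //.
  by do 3 rewrite -(mulrA _ _ (1 - B * _)); rewrite fE -gC IH gE !mulrA.
exact: commr_sym.
Qed.

(** * The noncommutative q-binomial series *)

Definition unisum (x : V) : V := limn (series (neg 1 x)).

(** At a = 1 the factor a - Q^0 kills every positive term, and the remaining term of index 0 becomes
    the first one of the unilateral series. *)
Lemma unisum_bisum : bisum 1 = unisum c.
Proof.
rewrite /bisum; have := @posX_cvg 0; rewrite expr0 => /cvg_lim -> //.
have cn := neg_cvg admissible1.
apply/esym/cvg_lim => //; rewrite -cvg_shiftS.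
rewrite (_ : (fun n => _) = (fun n => series (pos 1) 1 +
  series (fun k => neg 1 c k.+1) n)).
  by apply: cvgD => //; exact: cvg_cst.
apply/funext => n; rewrite /series /= big_nat1 big_nat_recl //.
by rewrite /pos_term /neg_term !lprod0.
Qed.

Lemma neg1_exp n k : neg 1 (c * Q ^+ n) k = neg 1 c k * (Q ^+ k) ^+ n.
Proof.
elim: n => [|n IH]; first by rewrite !expr0 !mulr1.
rewrite exprSr mulrA neg_term_scale //; last by comm.
by rewrite IH -mulrA -exprSr.
Qed.

Lemma neg1_bound : exists M r,
  [/\ 0 <= M, 0 <= r < 1 & forall n k, `|neg 1 (c * Q ^+ n) k| <= M * r ^+ k].
Proof.
have [M [r [M0 r01 H]]] := neg_bound admissible1.
exists M, r; split => // n k.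
rewrite neg1_exp -exprM; apply: le_trans (norm_mulX_le _ _ Q_lt1) _.
by have := H 0%N k; rewrite expr0 mulr1.
Qed.

Lemma neg1_cvg n : cvgn (series (neg 1 (c * Q ^+ n))).
Proof.
have [M [r [M0 r01 H]]] := neg1_bound; exact: (@geo_cvg_series K V _ M r).
Qed.

(** In the limit the recurrence S(d) (1 - B d) = S(d Q) (1 - Q d) holds at d = c Q^n, where 1 - B d
    is inverted by a Neumann series. *)
Lemma unisum_rprod n :
  unisum c = unisum (c * Q ^+ n) * rprod (qratio (c * Q) (B * c) Q) n.
Proof.
elim: n => [|n IH]; first by rewrite rprod0 expr0 !mulr1.
rewrite rprodS mulrA IH; congr (_ * _).
set d := c * Q ^+ n; have Qd : GRing.comm Q d by rewrite /d; comm.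
have QU i : 1 - Q ^+ i.+1 \is a GRing.unit.
  by have [_ _ _] := admissible1 => /(_ i); rewrite mul1r.
have E m := q_binomial_partial QB m Qd QU; rewrite /= in E.
have cd : cvgn (series (neg 1 d)) by exact: neg1_cvg.
have dQ : d * Q = c * Q ^+ n.+1 by rewrite exprSr mulrA.
have cd' : cvgn (series (neg 1 (d * Q))) by rewrite dQ; exact: neg1_cvg.
have lhs : (fun m => series (neg 1 d) m.+1 - series (neg 1 (d * Q)) m.+1) @ \oo -->
    unisum d - unisum (d * Q).
  by apply: cvgB; exact: cvg_seriesS.
rewrite (funext E) in lhs.
have rhs : (fun m => series (neg 1 d) m * (B * d) - series (neg 1 (d * Q)) m * (Q * d))
    @ \oo --> unisum d * (B * d) - unisum (d * Q) * (Q * d).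
  by apply: cvgB; apply: banach_cvgM => //; exact: cvg_cst.
have e := cvg_unique (@norm_hausdorff K V) lhs rhs.
have eq_d : unisum d * (1 - B * d) = unisum (d * Q) * (1 - Q * d).
  rewrite !mulrBr !mulr1 -[X in X - _ = _](subrK (unisum (d * Q))) e.
  by rewrite addrAC (addrAC (_ * (B * d))) subrr add0r addrC.
have BdE : B * c * Q ^+ n = B * d by rewrite mulrA.
have BdU : 1 - B * d \is a GRing.unit.
  rewrite -BdE; apply: neumann.
  by apply: le_lt_trans (norm_mulX_le _ _ Q_lt1) _.
apply: (mulIr BdU); rewrite eq_d dQ /qratio BdE -!mulrA mulVr // mulr1.
by congr (_ * (_ - _)); rewrite Qd /d -!mulrA -exprS -exprSr.
Qed.

(** The k-th term at c Q^n carries the factor Q^(k n), so only the term k = 0, which is 1,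
    survives. *)
Lemma unisum_cvg : (fun n => unisum (c * Q ^+ n)) @ \oo --> (1 : V).
Proof.
have [M [r [M0 r01 H]]] := neg1_bound.
pose v (k : nat) : V := (k == 0%N)%:R.
have -> : 1 = limn (series v) :> V.
  apply/esym/cvg_lim => //; rewrite -cvg_shiftS.
  rewrite (_ : (fun n => _) = cst 1); first exact: cvg_cst.
  apply/funext => n; rewrite /series /= big_nat_recl // big1 ?addr0 //.
apply: (tannery r01 M0 H) => -[|k].
  rewrite (_ : (fun n => _) = cst 1); first exact: cvg_cst.
  by apply/funext => n; rewrite /neg_term lprod0.
rewrite /v /= (_ : (fun n => _) = (fun n => neg 1 c k.+1 * (Q ^+ k.+1) ^+ n)).
  apply: cvg_mulX; rewrite exprS.
  by apply: le_lt_trans (norm_mulX_le _ _ Q_lt1) _.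
by apply/funext => n; exact: neg1_exp.
Qed.

Lemma bisum_product a : admissible a -> `|a * C| < 1 ->
  bisum a = limn (rprod (qratio (c * Q) (B * c) Q)) * limn (lprod (qratio C B Q)) *
    limn (rprod (qratio (a * B) (a * C) Q)) * limn (lprod (qratio Q (a * Q) Q)).
Proof.
move=> ad aC1; have [aQ aB aC aU] := ad.
have ltX (x : V) : `|x| < 1 -> forall j, 1 - x * Q ^+ j \is a GRing.unit.
  by move=> x1 j; apply: neumann; apply: le_lt_trans (norm_mulX_le _ _ Q_lt1) _.
have aQU j : 1 - a * Q * Q ^+ j \is a GRing.unit by rewrite -mulrA -exprS.
have U0 j : 1 - 0 * Q ^+ j \is a GRing.unit by rewrite mul0r subr0 unitr1.
have cL : cvgn (rprod (qratio (c * Q) (B * c) Q)).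
  exact: rprod_qratio_cvg Q_lt1 (ltX _ Bc_lt1).
have cM : cvgn (lprod (qratio C B Q)) by exact: lprod_qratio_cvg.
have cR : cvgn (rprod (qratio (a * B) (a * C) Q)).
  exact: rprod_qratio_cvg Q_lt1 (ltX _ aC1).
have cS : cvgn (lprod (qratio Q (a * Q) Q)) by exact: lprod_qratio_cvg.
have cN : cvgn (lprod (qratio Q 0 Q)) by exact: lprod_qratio_cvg.
have cD : cvgn (lprod (qratio 0 (a * Q) Q)) by exact: lprod_qratio_cvg.
have haus := @norm_hausdorff K V.
have gL : unisum c = limn (rprod (qratio (c * Q) (B * c) Q)).
  have := banach_cvgM unisum_cvg cL; rewrite mul1r => lim.
  apply: (cvg_unique haus _ lim).
  rewrite (_ : (fun n => _) = cst (unisum c)); first exact: cvg_cst.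
  by apply/funext => n; rewrite -unisum_rprod.
(* [bisum_cvg] needs |a C| < 1, which may fail at a = 1; the limit along Q^n is therefore taken from
   some Q^N on. *)
have [N _ HN] : \forall n \near \oo, `|C| * `|Q| ^+ n < 1.
  have lim0 : (fun j => `|C| * `|Q| ^+ j) @ \oo --> 0.
    by have := @cvg_geometric K `|C| `|Q|; rewrite normr_id; apply.
  exact: (cvgr_lt _ lim0).
have {HN} QN : `|Q ^+ N * C| < 1.
  have -> : Q ^+ N * C = C * Q ^+ N by apply: commr_sym; comm.
  by apply: le_lt_trans (norm_mulX _ _ _) (HN N (leqnn N)).
have G0 : bisum 0 =
    unisum c * (limn (lprod (qratio C B Q)) * limn (lprod (qratio Q 0 Q))).
  have := bisum_cvg (admissible_exp N) QN.
  rewrite (_ : (fun n => _) = (fun n => bisum (Q ^+ (n + N)))); last first.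
    by apply/funext => n; rewrite -exprD addnC.
  rewrite (cvg_shiftn N (fun n => bisum (Q ^+ n))) => lim.
  apply: (cvg_unique haus lim).
  rewrite -unisum_bisum.
  rewrite (_ : (fun n => _) = (fun n => bisum 1 *
      (lprod (qratio C B Q) n * lprod (qratio Q 0 Q) n))).
    by apply: banach_cvgM; [exact: cvg_cst | exact: banach_cvgM].
  by apply/funext => n; exact: bisum_lprod.
have Ga : bisum a = bisum 0 *
    (limn (rprod (qratio (a * B) (a * C) Q)) * limn (lprod (qratio 0 (a * Q) Q))).
  have lim := banach_cvgM (bisum_cvg ad aC1) (banach_cvgM cR cD).
  apply: (cvg_unique haus _ lim).
  rewrite (_ : (fun n => _) = cst (bisum a)); first exact: cvg_cst.
  by apply/funext => n; rewrite -bisum_rprod.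
(* The product of the 1 - Q^(j+1), left over from the iteration at 1, commutes with the reversed
   product and can be moved next to the inverses of the 1 - a Q^(j+1) from the iteration at a, with
   which it merges. *)
have NR : GRing.comm (limn (lprod (qratio Q 0 Q)))
    (limn (rprod (qratio (a * B) (a * C) Q))).
  apply: commr_lim => // n; apply: commr_rprod => i; apply: commr_sym.
  by apply: commr_lprod => j; rewrite /qratio; comm.
have ND : limn (lprod (qratio Q (a * Q) Q)) =
    limn (lprod (qratio Q 0 Q)) * limn (lprod (qratio 0 (a * Q) Q)).
  apply: (cvg_unique haus cS).
  rewrite (_ : lprod (qratio Q (a * Q) Q) = (fun n => lprod (qratio Q 0 Q) n *
      lprod (qratio 0 (a * Q) Q) n)); first exact: banach_cvgM.
  apply/funext => n; rewrite -lprodM; last by move=> i j; rewrite /qratio; comm.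
  by apply: eq_lprod => i; rewrite /qratio !mul0r subr0 invr1 mulr1 mul1r.
by rewrite Ga G0 gL ND -!mulrA (mulrA (limn (lprod (qratio Q 0 Q)))) NR -!mulrA.
Qed.

End Core.

(** * Specialization to the shifted factorials *)

(** The image of [qratio] in the opposite algebra, which is also the factor of the type II
    factorial. *)
Definition qratio_op (V : unitRingType) (u v Q : V) (j : nat) : V :=
  (1 - v * Q ^+ j)^-1 * (1 - u * Q ^+ j).

Section Oprod.
Variable V : unitRingType.
Implicit Type X : int -> V.

Lemma oprod_nat X n : oprod 1 n%:Z X = lprod (fun i => X (i.+1%:Z)) n.
Proof.
rewrite /oprod subrr lez_nat leq0n subr0 absz_nat.
by apply: eq_bigr => i _; rewrite -PoszD add1n.
Qed.

Lemma oprod_Negz X n : oprod 1 (Negz n) X = lprod (fun i => (X (- i%:Z))^-1) n.+1.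
Proof. by rewrite /oprod subrr; apply: eq_bigr => i _; rewrite sub0r. Qed.

Variables (A B A' B' Q Z : V).

Lemma rqfac1_nat n :
  rqfac1 [tuple A] [tuple B] Q Z n%:Z = lprod (fun j => Z * qratio A B Q j) n.
Proof.
rewrite /rqfac1 oprod_nat; apply: eq_lprod => i.
rewrite big_ord_recl big_ord0 mulr1 !(tnth_nth 0) /= /qratio.
by have -> : (i.+1%:Z - 1 = i)%R by rewrite intS addrAC subrr add0r.
Qed.

Lemma rqfac2_nat n :
  rqfac2 [tuple A] [tuple B] Q Z n%:Z = rprod (fun j => Z * qratio A B Q j) n.
Proof.
rewrite /rqfac2 oprod_nat; apply: eq_bigr => i _.
rewrite big_ord_recl big_ord0 mulr1 !(tnth_nth 0) /= /qratio.
by rewrite subzn // exprnP.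
Qed.

Lemma rqfac2_nat2 n :
  rqfac2 [tuple A; A'] [tuple B; B'] Q 1 n%:Z =
  rprod (fun j => qratio A B Q j * qratio A' B' Q j) n.
Proof.
rewrite /rqfac2 oprod_nat; apply: eq_bigr => i _.
rewrite !big_ord_recl big_ord0 mulr1 mul1r !(tnth_nth 0) /= /qratio.
by rewrite subzn // exprnP.
Qed.

Lemma qfac2_nat n : qfac2 [tuple A] [tuple B] Q 1 n%:Z = lprod (qratio_op A B Q) n.
Proof.
rewrite /qfac2 oprod_nat; apply: eq_lprod => i.
rewrite big_ord_recl big_ord0 !mulr1 !(tnth_nth 0) /= /qratio_op.
by have -> : (i.+1%:Z - 1 = i)%R by rewrite intS addrAC subrr add0r.
Qed.

(** The index -n-1 inverts the factors with Q^-1, ..., Q^(-n-1) in both types; only their order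
    differs, which is why the exponent here is j + 1. *)
Definition inv_factor (j : nat) : V :=
  (Z * ((1 - A * Q ^- j.+1) * (1 - B * Q ^- j.+1)^-1))^-1.

Lemma rqfac1_Negz n :
  rqfac1 [tuple A] [tuple B] Q Z (Negz n) = lprod inv_factor n.+1.
Proof.
rewrite /rqfac1 oprod_Negz; apply: eq_lprod => i.
rewrite big_ord_recl big_ord0 mulr1 !(tnth_nth 0) /= /inv_factor.
by have -> : (- i%:Z - 1 = - (i.+1%:Z))%R by rewrite intS opprD addrC.
Qed.

Lemma rqfac2_Negz n :
  rqfac2 [tuple A] [tuple B] Q Z (Negz n) = rprod inv_factor n.+1.
Proof.
rewrite /rqfac2 oprod_Negz; apply: eq_bigr => i _.
rewrite big_ord_recl big_ord0 mulr1 !(tnth_nth 0) /= /inv_factor.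
have -> : (Negz n - - i%:Z = - ((n.+1 - i.+1).+1%:Z))%R.
  by have := ltn_ord i; rewrite NegzE; lia.
by [].
Qed.

End Oprod.

(** Trades a negative power for a positive one. It carries invertibility over from 1 - A Q^-m to 1 -
    A^-1 Q^m and brings the terms of negative index to the form of [neg_term]. *)
Lemma oneBMX_inv (V : unitRingType) (x Q : V) m :
  x \is a GRing.unit -> Q \is a GRing.unit -> GRing.comm x Q ->
  1 - x * Q ^- m = - (x * Q ^- m) * (1 - x^-1 * Q ^+ m).
Proof.
move=> xU QU xQ; rewrite mulrBr mulr1 mulNr opprK.
have -> : x * Q ^- m * (x^-1 * Q ^+ m) = 1; last by rewrite addrC.
have -> : x^-1 * Q ^+ m = Q ^+ m * x^-1 by apply: commr_sym; comm.
by rewrite mulrA mulrVK ?unitrX // mulrV.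
Qed.

Lemma inv_factorE (V : unitRingType) (A B Q Z : V) j :
  A \is a GRing.unit -> Q \is a GRing.unit -> Z \is a GRing.unit ->
  GRing.comm A Q -> GRing.comm B Q -> GRing.comm A B ->
  1 - A * Q ^- j.+1 \is a GRing.unit -> 1 - B * Q ^- j.+1 \is a GRing.unit ->
  1 - A^-1 * Q ^+ j.+1 \is a GRing.unit ->
  inv_factor A B Q Z j =
  (B - Q ^+ j.+1) * A^-1 * (1 - A^-1 * Q ^+ j.+1)^-1 * Z^-1.
Proof.
move=> AU QU ZU AQ BQ AB AjU BjU aU; rewrite /inv_factor.
set q := Q ^+ j.+1 in AjU BjU aU *.
have qU : q \is a GRing.unit by rewrite unitrX.
rewrite invrM ?unitrMl ?unitrV //; congr (_ * _).
rewrite invrM ?unitrV // invrK.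
apply: (mulIr AjU); rewrite mulrVK // (oneBMX_inv _ AU QU AQ) -/q.
have h : GRing.comm (1 - A^-1 * q)^-1 (A * q^-1) by rewrite /q; comm.
have e : (B - q) / A / (1 - A^-1 * q) * (A / q * (1 - A^-1 * q)) = (B - q) / q.
  by rewrite mulrA -(mulrA _ _ (A / q)) h (mulrA _ (A / q)) mulrVK // mulrA mulrVK.
by rewrite mulNr mulrN e mulrBl mulrV // opprB.
Qed.

Section Conjugation.

Lemma lprod_conj (V : unitRingType) (Z : V) (F G : nat -> V) :
  Z \is a GRing.unit -> (forall j, F j = Z * G j * Z^-1) ->
  forall n, lprod F n = Z * lprod G n * Z^-1.
Proof.
move=> ZU FG; elim=> [|n IH]; first by rewrite !lprod0 mulr1 mulrV.
by rewrite !lprodS IH FG !mulrA mulrVK.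
Qed.

Lemma rprod_conj (V : unitRingType) (Z : V) (F G : nat -> V) :
  Z \is a GRing.unit -> (forall j, F j = Z * G j * Z^-1) ->
  forall n, rprod F n = Z * rprod G n * Z^-1.
Proof.
move=> ZU FG; elim=> [|n IH]; first by rewrite !rprod0 mulr1 mulrV.
by rewrite !rprodS IH FG !mulrA mulrVK.
Qed.

Variables (K : realType) (V : banachAlgType K).

Lemma oo_limP (f : int -> V) (u : nat -> V) :
  (forall n : nat, f n%:Z = u n) -> cvgn u -> oo_cvg f /\ oo_lim f = limn u.
Proof. by move=> fu cu; rewrite /oo_cvg /oo_lim (funext fu). Qed.

Lemma series_conj (Z W : V) (p : nat -> V) (l : V) : series p @ \oo --> l ->
  series (fun n => Z * p n * W) @ \oo --> Z * l * W.
Proof.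
move=> pl; rewrite (_ : series _ = (fun n => Z * series p n * W)).
  apply: banach_cvgM; last exact: cvg_cst.
  by apply: banach_cvgM => //; exact: cvg_cst.
by apply/funext => n; rewrite /series /= mulr_sumr mulr_suml.
Qed.

Lemma bilateral_conj (Z W : V) (f : int -> V) (p m : nat -> V) :
  (forall n : nat, f n%:Z = Z * p n * W) -> (forall n, f (Negz n) = Z * m n * W) ->
  cvgn (series p) -> cvgn (series m) ->
  bilateral_cvg f /\
  bilateral_sum f = Z * (limn (series p) + limn (series m)) * W.
Proof.
move=> fp fm cp cm; rewrite /bilateral_cvg /bilateral_sum.
rewrite (funext fp) (funext fm).
have lp := @series_conj Z W _ _ cp; have lm := @series_conj Z W _ _ cm.
split; first by split; [exact: cvgP lp | exact: cvgP lm].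
by rewrite (cvg_lim _ lp) // (cvg_lim _ lm) // mulrDr mulrDl.
Qed.

End Conjugation.

Section Dual.
Variables (K : realType) (V : banachAlgType K).
Local Notation W := (banach_op V).

Lemma op_1BM (x Q : V) j : GRing.comm Q x ->
  (1 : W) - (x : W) * (Q : W) ^+ j = 1 - x * Q ^+ j :> V.
Proof.
by move=> Qx; rewrite opX opB opM; congr (1 - _); apply: commr_sym; comm.
Qed.

Lemma op_qratio (u v Q : V) : GRing.comm Q u -> GRing.comm Q v ->
  qratio (u : W) (v : W) (Q : W) = qratio_op u v Q :> (nat -> V).
Proof.
move=> Qu Qv; apply/funext => j; rewrite /qratio /qratio_op.
by rewrite -(op_1BM j Qu) -(op_1BM j Qv) -opV.
Qed.

Lemma op_1BM_unit (v Q : V) j : GRing.comm Q v -> 1 - v * Q ^+ j \is a GRing.unit ->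
  (1 : W) - (v : W) * (Q : W) ^+ j \is a GRing.unit.
Proof. by move=> Qv vU; rewrite op_unit op_1BM. Qed.

Lemma lprod_qratio_op_cvg (u v Q : V) :
  `|Q| < 1 -> GRing.comm Q u -> GRing.comm Q v ->
  (forall j, 1 - v * Q ^+ j \is a GRing.unit) -> cvgn (lprod (qratio_op u v Q)).
Proof.
move=> Q1 Qu Qv vU.
have := @rprod_qratio_cvg K W u v Q Q1 (fun j => op_1BM_unit Qv (vU j)).
by rewrite op_qratio // op_rprod.
Qed.

Lemma rprod_qratio_op_cvg (u v Q : V) :
  `|Q| < 1 -> GRing.comm Q u -> GRing.comm Q v ->
  (forall j, 1 - v * Q ^+ j \is a GRing.unit) -> cvgn (rprod (qratio_op u v Q)).
Proof.
move=> Q1 Qu Qv vU.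
have := @lprod_qratio_cvg K W u v Q Q1 (fun j => op_1BM_unit Qv (vU j)).
by rewrite op_qratio // op_lprod.
Qed.

(** [bisum_product] in the opposite algebra, read back: all products are reversed, so the hypothesis
    there on B c bounds [c * B] here, and the four limits come in the opposite order. *)
Lemma bisum_product_dual (a B C c Q : V) :
  `|Q| < 1 -> `|c * B| < 1 -> `|C * a| < 1 -> C * c = 1 -> c * C = 1 ->
  GRing.comm Q B -> GRing.comm Q C ->
  GRing.comm a Q -> GRing.comm a B -> GRing.comm a C ->
  (forall i, 1 - B * Q ^+ i \is a GRing.unit) ->
  (forall i, 1 - a * Q ^+ i.+1 \is a GRing.unit) ->
  let p := rprod (fun i => (1 - B * Q ^+ i)^-1 * (C * (a - Q ^+ i))) in
  let m := rprod (fun i => (1 - a * Q ^+ i.+1)^-1 * (c * (B - Q ^+ i.+1))) in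
  [/\ cvgn (series p), cvgn (series (fun k => m k.+1)) &
    limn (series p) + limn (series (fun k => m k.+1)) =
    limn (rprod (qratio_op Q (Q * a) Q)) * (limn (lprod (qratio_op (B * a) (C * a) Q)) *
    (limn (rprod (qratio_op C B Q)) * limn (lprod (qratio_op (Q * c) (c * B) Q))))].
Proof.
move=> Q1 cB1 Ca1 Cc cC QB QC aQ aB aC BU aU p m.
have Qa := commr_sym aQ.
have Qc : GRing.comm Q c := comm_c Cc cC QC.
have BU' j : (1 : W) - (B : W) * (Q : W) ^+ j \is a GRing.unit.
  exact: op_1BM_unit.
have adm : @admissible K W B C Q a.
  split; [exact: esym aQ | exact: esym aB | exact: esym aC | move=> i].
  exact: op_1BM_unit.
have posE : @pos_term W B C Q a = p :> (nat -> V).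
  rewrite /p -op_lprod; apply/funext => k; apply: (@eq_lprod W) => i.
  by rewrite -(op_1BM i QB) -opV -opX.
have negE : @neg_term W B Q a c = m :> (nat -> V).
  rewrite /m -op_lprod; apply/funext => k; apply: (@eq_lprod W) => i.
  by rewrite -(op_1BM i.+1 Qa) -opV -opX.
have cp := @pos_cvg K W B C Q Q1 (esym QC) BU' a (esym aQ) Ca1.
have cm := @neg_cvg K W B C c Q Q1 cB1 cC Cc (esym QC) a adm.
rewrite posE in cp; rewrite negE in cm; split => //.
have := @bisum_product K W B C c Q Q1 cB1 cC Cc (esym QB) (esym QC) BU' a adm Ca1.
rewrite /bisum posE negE.
have comm_op (x y : V) : GRing.comm Q x -> GRing.comm Q y -> GRing.comm Q (y * x).
  by move=> Qx Qy; comm.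
rewrite (@op_qratio (Q * c) (c * B) Q (comm_op _ _ Qc (commr_refl _)) (comm_op _ _ QB Qc)).
rewrite (@op_qratio C B Q QC QB).
rewrite (@op_qratio (B * a) (C * a) Q (comm_op _ _ Qa QB) (comm_op _ _ Qa QC)).
rewrite (@op_qratio Q (Q * a) Q (commr_refl _) (comm_op _ _ Qa (commr_refl _))).
rewrite !op_rprod !op_lprod.
exact.
Qed.

End Dual.

Theorem theorem3p5 (K : realType) (R : banachAlgType K) (A B Q Z : R)
  (QA : GRing.comm Q A) (QB : GRing.comm Q B) (QZ : GRing.comm Q Z)
  (AB : GRing.comm A B) (AZ : GRing.comm A Z)
  (Q_lt1 : `|Q| < 1) (Z_lt1 : `|Z| < 1) (AZB_lt1 : `|A^-1 * Z^-1 * B| < 1)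
  (A_unit : A \is a GRing.unit) (Z_unit : Z \is a GRing.unit)
  (Q_unit : Q \is a GRing.unit)
  (BQ_unit : forall n : int, 1 - B * Q ^ n \is a GRing.unit)
  (AQ_unit : forall n : int, n < 0 -> 1 - A * Q ^ n \is a GRing.unit) :
  [/\ bilateral_cvg (rqfac1 [tuple A] [tuple B] Q Z),
      oo_cvg (rqfac2 [tuple A^-1 * Z^-1 * Q] [tuple A^-1 * Z^-1 * B] Q 1),
      oo_cvg (rqfac1 [tuple Z * A] [tuple Z^-1 * B * Z] Q 1),
      oo_cvg (rqfac2 [tuple A^-1 * Z^-1 * B * Z; Q] [tuple Z; A^-1 * Q] Q 1)
    & rpsi1 A B Q Z =
      Z * oo_lim (rqfac2 [tuple A^-1 * Z^-1 * Q] [tuple A^-1 * Z^-1 * B] Q 1)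
        * oo_lim (rqfac1 [tuple Z * A] [tuple Z^-1 * B * Z] Q 1)
        * oo_lim (rqfac2 [tuple A^-1 * Z^-1 * B * Z; Q] [tuple Z; A^-1 * Q] Q 1)
        * Z^-1]
  /\
  [/\ bilateral_cvg (rqfac2 [tuple A] [tuple B] Q Z),
      oo_cvg (qfac2 [tuple B * A^-1] [tuple Z] Q 1),
      oo_cvg (rqfac2 [tuple Q; Z * A] [tuple B; A^-1 * Q] Q 1),
      oo_cvg (qfac2 [tuple A^-1 * Z^-1 * Q] [tuple A^-1 * Z^-1 * B] Q 1)
    & rpsi2 A B Q Z =
      Z * oo_lim (qfac2 [tuple B * A^-1] [tuple Z] Q 1)
        * oo_lim (rqfac2 [tuple Q; Z * A] [tuple B; A^-1 * Q] Q 1)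
        * oo_lim (qfac2 [tuple A^-1 * Z^-1 * Q] [tuple A^-1 * Z^-1 * B] Q 1)
        * Z^-1].
Proof.
pose a := A^-1; pose c := A^-1 * Z^-1; pose C := Z * A.
have BU i : 1 - B * Q ^+ i \is a GRing.unit := BQ_unit i%:Z.
have BU' j : 1 - B * Q ^- j.+1 \is a GRing.unit := BQ_unit (Negz j).
have AU' j : 1 - A * Q ^- j.+1 \is a GRing.unit := AQ_unit (Negz j) isT.
have AQ : GRing.comm A Q by comm.
have aU i : 1 - a * Q ^+ i.+1 \is a GRing.unit.
  have := AU' i; rewrite oneBMX_inv // unitrMr // unitrN unitrMl ?unitrV //.
  by rewrite unitrX.
have ltX (x : R) : `|x| < 1 -> forall j, 1 - x * Q ^+ j \is a GRing.unit.
  by move=> x1 j; apply: neumann; apply: le_lt_trans (norm_mulX_le _ _ Q_lt1) _.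
have aQ : GRing.comm a Q by rewrite /a; comm.
have aB : GRing.comm a B by rewrite /a; comm.
have aZ : GRing.comm a Z by rewrite /a; comm.
have aC : GRing.comm a C by rewrite /a /C; comm.
have QC : GRing.comm Q C by rewrite /C; comm.
have Qc : GRing.comm Q c by rewrite /c; comm.
have Cc : C * c = 1 by rewrite /C /c mulrA mulrK // mulrV.
have cC : c * C = 1 by rewrite /C /c mulrA mulrVK // mulVr.
(* This is how |Z| < 1 becomes the convergence condition of the core identity. *)
have aCE : a * C = Z by rewrite aC /C /a mulrK.
have aQU j : 1 - a * Q * Q ^+ j \is a GRing.unit by rewrite -mulrA -exprS.
have haus := @norm_hausdorff K R.
have aqC i : (a - Q ^+ i) * C = (1 - A * Q ^+ i) * Z.
  rewrite /C -AZ mulrA; congr (_ * _); rewrite mulrBl mulVr //; congr (1 - _).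
  by apply: commr_sym; comm.
have Zc : Z * c = a by rewrite /c -/a mulrA -aZ mulrK.
split.
(* Reversed type I: pulling the conjugation by Z out of the terms replaces B by Y, while C = Z A is
   unchanged. *)
- pose Y := Z^-1 * B * Z.
  have QY : GRing.comm Q Y by rewrite /Y; comm.
  have aY : GRing.comm a Y by rewrite /Y; comm.
  have YE i : 1 - Y * Q ^+ i = Z^-1 * (1 - B * Q ^+ i) * Z.
    rewrite mulrBr mulr1 mulrBl mulVr // /Y; congr (1 - _).
    by rewrite -!mulrA; do 2!congr (_ * _); apply: commr_sym; comm.
  have YU i : 1 - Y * Q ^+ i \is a GRing.unit.
    by rewrite YE unitrMl // unitrMr ?unitrV.
  (* This turns the hypothesis on A^-1 Z^-1 B into the bound on Y c required by the core
     identity. *)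
  have YcE : Y * c = c * B.
    rewrite /Y /c -/a !mulrA -(mulrA _ Z) -aZ mulrA mulrK //.
    have h : GRing.comm a (Z^-1 * B) by comm.
    by rewrite -[RHS]mulrA h.
  have Yc1 : `|Y * c| < 1 by rewrite YcE.
  have aC1 : `|a * C| < 1 by rewrite aCE.
  have ad : admissible Y C Q a by split.
  have posE n : rqfac1 [tuple A] [tuple B] Q Z n%:Z = Z * pos_term Y C Q a n * Z^-1.
    rewrite rqfac1_nat; apply: lprod_conj => // j.
    rewrite aqC YE !invrM ?unitrMl ?unitrV ?unitrMr ?unitrV // invrK.
    by rewrite /qratio !mulrA mulrK // mulrK.
  have negE n : rqfac1 [tuple A] [tuple B] Q Z (Negz n) =
      Z * neg_term Y Q a c n.+1 * Z^-1.
    rewrite rqfac1_Negz; apply: lprod_conj => // j.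
    rewrite inv_factorE //; [|by comm..]; congr (_ * _).
    have e : Z * (Y - Q ^+ j.+1) = (B - Q ^+ j.+1) * Z.
      rewrite mulrBr mulrBl /Y !mulrA mulrV // mul1r; congr (_ - _).
      by apply: commr_sym; comm.
    by rewrite (mulrA Z) (mulrA Z (Y - _)) e -(mulrA _ Z c) Zc.
  have [cvgf sumf] := bilateral_conj posE negE (pos_cvg Q_lt1 QC YU aQ aC1)
    (neg_cvg Q_lt1 Yc1 Cc cC QC ad).
  have prod := bisum_product Q_lt1 Yc1 Cc cC QY QC YU ad aC1.
  rewrite aCE YcE in prod.
  have [||cL eL] := @oo_limP K R
    (rqfac2 [tuple A^-1 * Z^-1 * Q] [tuple A^-1 * Z^-1 * B] Q 1)
    (rprod (qratio (c * Q) (c * B) Q)).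
    by move=> n; rewrite rqfac2_nat; apply: eq_rprod => j; rewrite mul1r.
    by apply: rprod_qratio_cvg => //; exact: ltX.
  have [||cM eM] := @oo_limP K R (rqfac1 [tuple Z * A] [tuple Z^-1 * B * Z] Q 1)
    (lprod (qratio C Y Q)).
    by move=> n; rewrite rqfac1_nat; apply: eq_lprod => j; rewrite mul1r.
    exact: lprod_qratio_cvg.
  have cR : cvgn (rprod (qratio (a * Y) Z Q)) by apply: rprod_qratio_cvg => //; exact: ltX.
  have cS : cvgn (lprod (qratio Q (a * Q) Q)) by exact: lprod_qratio_cvg.
  have [||cRS eRS] := @oo_limP K R
    (rqfac2 [tuple A^-1 * Z^-1 * B * Z; Q] [tuple Z; A^-1 * Q] Q 1)
    (fun n => rprod (qratio (a * Y) Z Q) n * lprod (qratio Q (a * Q) Q) n).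
    (* The factors of the pair Q, A^-1 Q commute with all others, so they split off, and among
       themselves their order is immaterial. *)
    move=> n; rewrite rqfac2_nat2 rprodM; last first.
      by move=> i j; rewrite /qratio -/a; comm.
    by rewrite [X in _ * X]rprod_lprod ?/Y ?mulrA // => i j; rewrite /qratio; comm.
    by apply: cvgP; exact: banach_cvgM cR cS.
  split => //.
  rewrite /rpsi1 sumf eL eM eRS -/(bisum Y C c Q a) prod.
  by rewrite (cvg_lim haus (banach_cvgM cR cS)) !mulrA.
(* Reversed type II: in the opposite algebra B itself is the core parameter, and the terms are still
   conjugated by Z. *)
- have cB1 : `|c * B| < 1 by [].
  have CaE : C * a = Z by rewrite /C /a mulrK.
  have Ca1 : `|C * a| < 1 by rewrite CaE.
  have [cp cm prod] := bisum_product_dual Q_lt1 cB1 Ca1 Cc cC QB QC aQ aB aC BU aU.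
  rewrite CaE in prod.
  have posE n : rqfac2 [tuple A] [tuple B] Q Z n%:Z = Z *
      rprod (fun i => (1 - B * Q ^+ i)^-1 * (C * (a - Q ^+ i))) n * Z^-1.
    rewrite rqfac2_nat; apply: rprod_conj => // j.
    have h : GRing.comm C (a - Q ^+ j) by comm.
    have h2 : GRing.comm (1 - A * Q ^+ j) (1 - B * Q ^+ j)^-1 by comm.
    by rewrite h aqC /qratio h2 !mulrA mulrK.
  have negE n : rqfac2 [tuple A] [tuple B] Q Z (Negz n) = Z *
      rprod (fun i => (1 - a * Q ^+ i.+1)^-1 * (c * (B - Q ^+ i.+1))) n.+1 * Z^-1.
    rewrite rqfac2_Negz; apply: rprod_conj => // j.
    rewrite inv_factorE //; [|by comm..]; congr (_ * _).
    have h : GRing.comm Z (1 - a * Q ^+ j.+1)^-1 by comm.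
    have h2 : GRing.comm (a * (1 - a * Q ^+ j.+1)^-1) (B - Q ^+ j.+1) by comm.
    have h3 : GRing.comm a (1 - a * Q ^+ j.+1)^-1 by comm.
    by rewrite (mulrA Z) h -(mulrA _ Z) (mulrA Z) Zc mulrA -h3 h2 mulrA.
  have [cvgf sumf] := bilateral_conj posE negE cp cm.
  have ZU j : 1 - Z * Q ^+ j \is a GRing.unit by exact: ltX.
  have cBU j : 1 - c * B * Q ^+ j \is a GRing.unit by exact: ltX.
  have [||cL eL] := @oo_limP K R
    (qfac2 [tuple A^-1 * Z^-1 * Q] [tuple A^-1 * Z^-1 * B] Q 1)
    (lprod (qratio_op (Q * c) (c * B) Q)).
    by move=> n; rewrite qfac2_nat Qc.
    by apply: lprod_qratio_op_cvg => //; comm.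
  have [||cR eR] := @oo_limP K R (qfac2 [tuple B * A^-1] [tuple Z] Q 1)
    (lprod (qratio_op (B * a) Z Q)).
    by move=> n; rewrite qfac2_nat.
    by apply: lprod_qratio_op_cvg => //; comm.
  have cM : cvgn (rprod (qratio_op C B Q)) by apply: rprod_qratio_op_cvg.
  have cS : cvgn (rprod (qratio_op Q (Q * a) Q)).
    by apply: rprod_qratio_op_cvg => //; [comm | rewrite -aQ].
  have [||cMS eMS] := @oo_limP K R (rqfac2 [tuple Q; Z * A] [tuple B; A^-1 * Q] Q 1)
    (fun n => rprod (qratio_op C B Q) n * rprod (qratio_op Q (Q * a) Q) n).
    move=> n; rewrite rqfac2_nat2 -rprodM; last first.
      by move=> i j; rewrite /qratio_op; comm.
    apply: eq_rprod => j; rewrite /qratio /qratio_op -/a -/C -aQ.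
    set x := (1 - B * _)^-1; set y := 1 - C * _; set t := (1 - a * _ * _)^-1.
    have h : GRing.comm (1 - Q * Q ^+ j) (x * (y * t)) by rewrite /x /y /t; comm.
    by rewrite -mulrA h -!mulrA.
    by apply: cvgP; exact: banach_cvgM cM cS.
  split => //.
  rewrite /rpsi2 sumf eL eR eMS prod (cvg_lim haus (banach_cvgM cM cS)).
  have cR' : cvgn (lprod (qratio_op (B * a) Z Q)).
    by apply: lprod_qratio_op_cvg => //; comm.
  have SR : GRing.comm (limn (rprod (qratio_op Q (Q * a) Q)))
      (limn (lprod (qratio_op (B * a) Z Q))).
    apply: commr_lim => // n; apply: commr_sym; apply: commr_rprod => i.
    by apply: commr_sym; apply: commr_lprod => k; rewrite /qratio_op; comm.
  have SM : GRing.comm (limn (rprod (qratio_op Q (Q * a) Q)))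
      (limn (rprod (qratio_op C B Q))).
    apply: commr_lim => // n; apply: commr_sym; apply: commr_rprod => i.
    by apply: commr_sym; apply: commr_rprod => k; rewrite /qratio_op; comm.
  (* The limit that comes first in the dual formula commutes with the next two and is moved past
     them, to be grouped with the factors of C and B in one factorial. *)
  rewrite (mulrA (limn (rprod (qratio_op Q (Q * a) Q)))) SR -!mulrA.
  by rewrite (mulrA (limn (rprod (qratio_op Q (Q * a) Q)))) SM -!mulrA.
Qed.
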